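(* Let ${\bf S}\subset\mathbb{R}^3$ be the sphere of center $(0,0,1/2)$ and radius $1/2$, let $K$ be a closed subset of ${\bf S}$ which is not log-polar, and let $Q\in\mathcal A(K)$. Let $p_k(x)=\prod_{j=1}^k|x-x_j|$, $x\in{\bf S}$, with $x_1,\dots,x_k\in{\bf S}$, and assume $|p_k(x)e^{-kQ(x)}|\le M$ for $x\in S_w\setminus P$ with $P$ log-polar (possibly empty). Then $|p_k(x)|\le M\exp\big(k(-U^{\mu_{K,Q}}(x)+F_w)\big)$ for all $x\in{\bf S}$, and $|p_k(x)e^{-kQ(x)}|\le M$ for $x\in K\setminus\tilde P$ with $\tilde P$ log-polar (possibly empty).
   Context: $I(\mu)=\int\int\log\frac1{|x-y|}d\mu d\mu$ (Euclidean distance in $\mathbb{R}^3$); a compact set is log-polar if every Borel probability measure on it has $I(\mu)=\infty$, a Borel set if all its compact subsets are. $\mathcal A(K)$: lower semicontinuous $Q:K\to(-\infty,\infty]$ with $\{Q<\infty\}$ not log-polar. $I^Q(\mu)=I(\mu)+2\int Q\,d\mu$, $V_w=\inf I^Q$ over probability measures on $K$, $\mu_{K,Q}$ the unique minimizer, $S_w=\operatorname{supp}\mu_{K,Q}$, $F_w=V_w-\int Q\,d\mu_{K,Q}$, $U^\mu(x)=\int\log\frac1{|x-y|}d\mu(y)$. *)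

(* Defs.v *)
From HB Require Import structures.
From mathcomp Require Import all_boot all_order all_algebra.
From mathcomp Require Import all_classical all_reals all_analysis.
Set Implicit Arguments. Unset Strict Implicit. Unset Printing Implicit Defensive.
Import Order.TTheory GRing.Theory Num.Theory.
Import numFieldNormedType.Exports.
Local Open Scope classical_set_scope.
Local Open Scope ring_scope.

Section Defs.
Variable R : realType.

(* Points of R^3, as triples ((a, b), c); product topology / product (Borel)
   sigma-algebra. *)
Definition pt3 := (R * R * R)%type.

Definition edist (x y : pt3) : R :=
  Num.sqrt ((x.1.1 - y.1.1) ^+ 2 + (x.1.2 - y.1.2) ^+ 2 + (x.2 - y.2) ^+ 2).

Definition sphereS : set pt3 :=
  [set x | x.1.1 ^+ 2 + x.1.2 ^+ 2 + (x.2 - 2^-1) ^+ 2 = 4^-1].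

Definition lker (x y : pt3) : \bar R :=
  if x == y then +oo%E else (- ln (edist x y))%:E.

Definition energy (mu : probability pt3 R) : \bar R :=
  (\int[mu]_x \int[mu]_y lker x y)%E.

Definition Upot (mu : probability pt3 R) (x : pt3) : \bar R :=
  (\int[mu]_y lker x y)%E.

Definition prob_on (K : set pt3) (mu : probability pt3 R) : Prop :=
  mu (~` K) = 0%E.

Definition logpolar_compact (C : set pt3) : Prop :=
  forall mu : probability pt3 R, prob_on C mu -> energy mu = +oo%E.

Definition logpolar (B : set pt3) : Prop :=
  measurable B /\
  forall C : set pt3, compact C -> C `<=` B -> logpolar_compact C.

Definition lsc_on (K : set pt3) (Q : pt3 -> \bar R) : Prop :=
  forall x, K x -> forall a : \bar R, (a < Q x)%E ->
    \forall y \near x, K y -> (a < Q y)%E.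

Definition admissible (K : set pt3) (Q : pt3 -> \bar R) : Prop :=
  [/\ lsc_on K Q, (forall x, K x -> Q x != -oo%E) &
      ~ logpolar [set x | K x /\ (Q x < +oo)%E]].

Definition wenergy (K : set pt3) (Q : pt3 -> \bar R)
  (mu : probability pt3 R) : \bar R :=
  (energy mu + 2%:E * \int[mu]_(x in K) Q x)%E.

Definition Vw (K : set pt3) (Q : pt3 -> \bar R) : \bar R :=
  ereal_inf [set wenergy K Q nu | nu in [set nu | prob_on K nu]].

(* mu is a minimizer of I^Q among probability measures on K
   (by uniqueness, mu = mu_{K,Q}). *)
Definition is_eq_measure (K : set pt3) (Q : pt3 -> \bar R)
  (mu : probability pt3 R) : Prop :=
  prob_on K mu /\ forall nu, prob_on K nu -> (wenergy K Q mu <= wenergy K Q nu)%E.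

Definition Fw (K : set pt3) (Q : pt3 -> \bar R)
  (mu : probability pt3 R) : \bar R :=
  (Vw K Q - \int[mu]_(x in K) Q x)%E.

Definition supp (mu : probability pt3 R) : set pt3 :=
  [set x | forall U : set pt3, open U -> U x -> (0 < mu U)%E].

Definition pk (k : nat) (xs : 'I_k -> pt3) (x : pt3) : R :=
  \prod_(j < k) edist x (xs j).

End Defs.

(* Main.v *)
From HB Require Import structures.
From mathcomp Require Import all_boot all_order all_algebra.
From mathcomp Require Import all_classical all_reals all_analysis.
From mathcomp Require Import measurable_realfun ring lra.
Require Import Defs.
Set Implicit Arguments. Unset Strict Implicit. Unset Printing Implicit Defensive.
Import Order.TTheory GRing.Theory Num.Theory.
Import numFieldNormedType.Exports.
Local Open Scope classical_set_scope.
Local Open Scope ring_scope.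

(** Frostman's conditions: perturbing [mu] towards a competitor [nu] of finite energy
    gives [\int (U + Q) dnu >= Fw], so [U + Q >= Fw] quasi-everywhere on [K]; testing
    with conditional measures of [mu] and using lower semicontinuity, [U + Q <= Fw] on
    all of [supp mu]. Hence [p_k exp (k U) <= M exp (k Fw)] on [supp mu] minus a
    log-polar set, and then on all of [supp mu], because a log-polar set contains no
    relatively open part of the support, [p_k] is continuous and [U] is lower
    semicontinuous.

    It remains to extend this bound to the sphere (principle of domination). Let [t > 1]
    and [H = p_k exp (k t U)]. Near the support [H] is controlled by its values on the
    support: if [y] is the point of the support nearest to [x] then
    [|y - w| <= 2 |x - w|] for [w] in the support, and the factor 2 matters only for [w]
    in a small ball around [y], whose mass is small because [U y] is bounded. So if [H]
    exceeded its supremum on the support, it would attain its maximum at some [x0] off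
    the support. The vertices [x_j] of a small square centred at [x0] satisfy
    [prod_j |x_j - w| = |x0 - w|^4 (1 - h + O(h^2))], with [h] one minus the cosine of the
    angular radius, uniformly for [w] away from [x0]; comparing the masses [k] of the
    zeros of [p_k] and [k t > k] of [k t mu] gives [prod_j H x_j > H x0 ^ 4] for small
    [h], a contradiction. Finally let [t] tend to 1. *)

(** * First variation of the weighted energy *)

(** The right-hand side is a quadratic in [t] that equals the left-hand side at [t = 0] and has
    derivative [2 * (b + r - a - p)] there, which therefore cannot be negative. *)
Lemma first_variation (R : realType) (a b c p r : R) :
  (forall t : R, 0 < t < 1 ->
    a + 2 * p <= (1 - t) ^+ 2 * a + 2 * t * (1 - t) * b + t ^+ 2 * c +
                 2 * ((1 - t) * p + t * r)) -> (a + p <= b + r).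
Proof.
move=> H; rewrite leNgt; apply/negP => lt.
set e := (a + p - b - r); have e0 : (0 < e) by rewrite /e; lra.
(* [k] exceeds [e], so that [e / k < 1], and exceeds the quadratic coefficient, so that at
   [t = e / k] the quadratic term stays below the linear loss [2 * t * e]. *)
set k := (1 + e + `|a - 2 * b + c|).
have k0 : (0 < k) by rewrite /k; have := normr_ge0 (a - 2 * b + c); lra.
have kk : (a - 2 * b + c < k) by rewrite /k; have := ler_norm (a - 2 * b + c); lra.
have ek : (e < k) by rewrite /k; have := normr_ge0 (a - 2 * b + c); lra.
have t01 : (0 < e / k < 1) by rewrite divr_gt0//= ltr_pdivrMr// mul1r.
have := H _ t01.
have tk : (e / k * k = e) by rewrite divfK// gt_eqF.
move: t01 tk; set t := (e / k) => /andP[t0 t1] tk.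
rewrite -subr_ge0.
have -> : (1 - t) ^+ 2 * a + 2 * t * (1 - t) * b + t ^+ 2 * c +
    2 * ((1 - t) * p + t * r) - (a + 2 * p) = t * (t * (a - 2 * b + c) - 2 * e).
  by rewrite /e; ring.
rewrite pmulr_rge0// leNgt => /negP; apply.
rewrite subr_lt0 (@lt_trans _ _ (t * k))// ?ltr_pM2l// tk; lra.
Qed.

(** * Mixtures and conditional measures *)

Section Probability.
Context d (T : measurableType d) (R : realType).
Implicit Types (mu nu : probability T R) (f : T -> \bar R).
Local Open Scope ereal_scope.

Lemma mixture_exists mu nu (t : R) : (0 <= t <= 1)%R ->
  exists tau : probability T R,
    (forall A, measurable A -> tau A = (1 - t)%:E * mu A + t%:E * nu A) /\
    (forall f, measurable_fun setT f -> (forall x, 0 <= f x) ->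
      \int[tau]_x f x = (1 - t)%:E * \int[mu]_x f x + t%:E * \int[nu]_x f x).
Proof.
move=> /andP[t0 t1].
have t1' : (0 <= 1 - t)%R by rewrite subr_ge0.
pose m : {measure set T -> \bar R} := measure_add (mscale (NngNum t1') mu) (mscale (NngNum t0) nu).
have mE A : m A = (1 - t)%:E * mu A + t%:E * nu A.
  by rewrite [LHS]measure_addE.
have m1 : m setT = 1.
  by rewrite mE !probability_setT !mule1 -EFinD subrK.
(* [m] has mass 1 already: normalizing leaves it unchanged and only supplies the structure of a
   probability measure. *)
exists (mnormalize m mu).
have nE A : mnormalize m mu A = m A.
  rewrite /mnormalize m1/= onee_eq0/=.
  by rewrite invr1 mule1.
split=> [A mA|f mf f0]; first by transitivity (m A); [exact: nE|exact: mE].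
transitivity (\int[m]_x f x); first by apply: eq_measure_integral => A _ _; exact: nE.
by rewrite /m ge0_integral_measure_add// !ge0_integral_mscale.
Qed.

Lemma conditional_exists mu (A : set T) : measurable A -> 0 < mu A ->
  exists nu : probability T R,
    (forall B, measurable B -> nu B = (fine (mu A))^-1%:E * mu (B `&` A)) /\
    (forall f, measurable_fun setT f -> (forall x, 0 <= f x) ->
      \int[nu]_x f x = (fine (mu A))^-1%:E * \int[mu]_(x in A) f x).
Proof.
move=> mA A0.
have muAfin : mu A \is a fin_num by exact: fin_num_measure.
have r0 : (0 < fine (mu A))%R by rewrite fine_gt0// A0/= ltey_eq muAfin.
have i0 : (0 <= (fine (mu A))^-1)%R by rewrite invr_ge0 ltW.
pose m : {measure set T -> \bar R} := mscale (NngNum i0) (mrestr mu mA).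
have mE B : m B = (fine (mu A))^-1%:E * mu (B `&` A) by [].
have m1 : m setT = 1.
  rewrite mE setTI -[X in _ * X]fineK//= -EFinM mulVf//.
  by rewrite gt_eqF.
have nE B : mnormalize m mu B = m B.
  rewrite /mnormalize m1/= onee_eq0/=.
  by rewrite invr1 mule1.
exists (mnormalize m mu); split=> [B mB|f mf f0]; first exact: nE.
transitivity (\int[m]_x f x); first by apply: eq_measure_integral => B _ _; exact: nE.
rewrite /m ge0_integral_mscale//=; congr (_ * _).
rewrite (@ge0_negligible_integral _ _ _ _ _ (~` A))//; last 2 first.
- exact: measurableC.
- by rewrite [LHS](_ : _ = mu (~` A `&` A))// setICl measure0.
rewrite setDE setCK setTI.
apply: eq_measure_integral => B mB BA.
by rewrite [LHS](_ : _ = mu (B `&` A))// (setIidl BA).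
Qed.

End Probability.

(** * The energy as a quadratic form, and its first variation *)

Section Variation.
Context d (T : measurableType d) (R : realType).
Variables (L : T * T -> \bar R) (q : T -> \bar R).
Hypotheses (mL : measurable_fun setT L) (L0 : forall z, (0 <= L z)%E).
Hypothesis (Lsym : forall x y, L (x, y) = L (y, x)).
Hypotheses (mq : measurable_fun setT q) (q0 : forall x, (0 <= q x)%E).
Implicit Types (mu nu rho : probability T R).
Local Open Scope ereal_scope.

Definition potential mu x := \int[mu]_y L (x, y).
Definition mutual_energy mu nu := \int[mu]_x potential nu x.
Definition weighted_energy mu := mutual_energy mu mu + 2%:E * \int[mu]_x q x.

Lemma measurable_potential mu : measurable_fun setT (potential mu).
Proof. exact: (measurable_fun_fubini_tonelli_F (m2 := mu) L mL L0). Qed.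

Lemma measurable_kernel x : measurable_fun setT (fun y => L (x, y)).
Proof. exact: measurableT_comp. Qed.

Lemma potential_ge0 mu x : 0 <= potential mu x.
Proof. exact: integral_ge0. Qed.

Lemma mutual_energy_ge0 mu nu : 0 <= mutual_energy mu nu.
Proof. by apply: integral_ge0 => x _; exact: potential_ge0. Qed.

Lemma mutual_energyC mu nu : mutual_energy mu nu = mutual_energy nu mu.
Proof.
rewrite /mutual_energy /potential.
have := fubini_tonelli (m1 := mu) (m2 := nu) L mL L0.
rewrite /fubini_F /fubini_G => ->.
by apply: eq_integral => x _; apply: eq_integral => y _; exact: Lsym.
Qed.

Lemma energy_mixture mu nu (tau : probability T R) (t : R) : (0 <= t <= 1)%R ->
  (forall f, measurable_fun setT f -> (forall x, 0 <= f x) ->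
      \int[tau]_x f x = (1 - t)%:E * \int[mu]_x f x + t%:E * \int[nu]_x f x) ->
  mutual_energy tau tau =
    ((1 - t) ^+ 2)%:E * mutual_energy mu mu +
    (2 * t * (1 - t))%:E * mutual_energy mu nu + (t ^+ 2)%:E * mutual_energy nu nu.
Proof.
move=> /andP[t0 t1] H.
have t1' : (0 <= 1 - t)%R by rewrite subr_ge0.
have pE x : potential tau x = (1 - t)%:E * potential mu x + t%:E * potential nu x.
  by apply: H => // ; exact: measurable_kernel.
have mE (rho : probability T R) : mutual_energy rho tau =
    (1 - t)%:E * mutual_energy rho mu + t%:E * mutual_energy rho nu.
  rewrite /mutual_energy; under eq_integral do rewrite pE.
  rewrite ge0_integralD//; last 4 first.
  - by move=> x _; rewrite mule_ge0 ?potential_ge0// lee_fin.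
  - by apply: measurable_funeM; exact: measurable_potential.
  - by move=> x _; rewrite mule_ge0 ?potential_ge0// lee_fin.
  - by apply: measurable_funeM; exact: measurable_potential.
  rewrite !ge0_integralZl//; try exact: measurable_potential;
    by move=> *; exact: potential_ge0.
rewrite mE !(mutual_energyC tau) !mE (mutual_energyC nu mu).
move: (mutual_energy_ge0 mu mu) (mutual_energy_ge0 mu nu) (mutual_energy_ge0 nu nu).
move: (mutual_energy mu mu) (mutual_energy mu nu) (mutual_energy nu nu) => a b c a0 b0 c0.
rewrite !ge0_muleDr ?mule_ge0 ?lee_fin// !muleA -!EFinM -!expr2 !addeA; congr (_ + _).
rewrite -!addeA; congr (_ + _).
rewrite -ge0_muleDl ?lee_fin ?mulr_ge0//.
by congr (_ * _); rewrite -EFinD; congr EFin; ring.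
Qed.

Lemma weighted_energy_lty rho : weighted_energy rho < +oo ->
  mutual_energy rho rho < +oo /\ \int[rho]_x q x < +oo.
Proof.
have : 0 <= \int[rho]_x q x by exact: integral_ge0.
rewrite /weighted_energy; move: (mutual_energy_ge0 rho rho).
move: (\int[rho]_x q x) (mutual_energy rho rho) => [r| |] [s| |]//.
- by move=> _ _ _; rewrite !ltry.
- by rewrite mulry gtr0_sg// mul1e.
- by rewrite mulry gtr0_sg// mul1e.
Qed.

(** Both sides are a mutual energy plus an integral of [q]. If the mutual energy of [mu] and [nu] is
    infinite the right side is [+oo]; otherwise all terms are real and the energies of the mixtures
    feed [first_variation]. *)
Lemma minimizer_variation mu nu :
  (forall tau : probability T R, forall t : R, (0 < t < 1)%R ->
    (forall A, measurable A -> tau A = (1 - t)%:E * mu A + t%:E * nu A) ->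
    weighted_energy mu <= weighted_energy tau) ->
  weighted_energy mu < +oo -> weighted_energy nu < +oo ->
  \int[mu]_x (potential mu x + q x) <= \int[nu]_x (potential mu x + q x).
Proof.
move=> Hmin Jmu Jnu.
have intD (rho : probability T R) : \int[rho]_x (potential mu x + q x) =
    mutual_energy rho mu + \int[rho]_x q x.
  rewrite ge0_integralD//; [by move=> *; exact: potential_ge0|].
  exact: measurable_potential.
rewrite !intD (mutual_energyC nu mu).
have fins (rho : probability T R) : weighted_energy rho < +oo ->
    exists a p, mutual_energy rho rho = a%:E /\ \int[rho]_x q x = p%:E.
  move=> /weighted_energy_lty[].
  have : 0 <= \int[rho]_x q x by exact: integral_ge0.
  move: (mutual_energy_ge0 rho rho).
  move: (\int[rho]_x q x) (mutual_energy rho rho) => [r| |] [s| |]//.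
  by move=> _ _ _ _; exists s, r.
have [a [p [aE pE]]] := fins _ Jmu.
have [c [r [cE rE]]] := fins _ Jnu.
rewrite aE pE rE.
have := mutual_energy_ge0 mu nu.
case bE : (mutual_energy mu nu) => [b| |] _ //; last by rewrite addye// leey.
rewrite -!EFinD lee_fin; apply: (first_variation (c := c)) => t t01.
have t01' : (0 <= t <= 1)%R by case/andP: t01 => /ltW -> /ltW ->.
have [tau [tA tf]] := mixture_exists mu nu t01'.
have := Hmin tau t t01 tA.
rewrite /weighted_energy (energy_mixture t01' tf) (tf q mq q0).
rewrite bE aE cE pE rE.
by move=> h; rewrite -lee_fin; exact: h.
Qed.

(** The domination is applied once in each variable of the kernel, at the cost of a factor [c ^+ 2].
    Conditional measures of [mu] are the intended [nu]. *)
Lemma dominated_energy_lty mu nu (c : R) : (0 <= c)%R ->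
  (forall f, measurable_fun setT f -> (forall x, 0 <= f x) ->
    \int[nu]_x f x <= c%:E * \int[mu]_x f x) ->
  mutual_energy mu mu < +oo -> mutual_energy nu nu < +oo.
Proof.
move=> c0 H mufin.
apply: (@le_lt_trans _ _ (c%:E * (c%:E * mutual_energy mu mu))); last first.
  have := mutual_energy_ge0 mu mu; move: mufin.
  by case: (mutual_energy mu mu) => [r| |]// _ _; rewrite -!EFinM ltry.
apply: (le_trans (H _ (measurable_potential nu) (potential_ge0 nu))).
apply: lee_wpmul2l; first by rewrite lee_fin.
rewrite /mutual_energy -ge0_integralZl//; last 2 first.
- exact: measurable_potential.
- by move=> x _; exact: potential_ge0.
apply: ge0_le_integral => //.
- by move=> x _; exact: potential_ge0.
- exact: measurable_potential.
- by apply: measurable_funeM; exact: measurable_potential.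
- by move=> x _; apply: H => //; exact: measurable_kernel.
Qed.

(** * Frostman's inequalities for a minimizer *)

Section Minimizer.
Variables (K : set T) (mu : probability T R).
Hypotheses (mK : measurable K) (muK : mu (~` K) = 0).
Hypothesis mu_min : forall tau : probability T R, tau (~` K) = 0 ->
  weighted_energy mu <= weighted_energy tau.
Hypothesis mu_fin : weighted_energy mu < +oo.
Let g x := potential mu x + q x.
Let F := \int[mu]_x g x.

Let g0 x : 0 <= g x.
Proof. by rewrite adde_ge0// potential_ge0. Qed.

Let mg : measurable_fun setT g.
Proof. by apply: emeasurable_funD => //; exact: measurable_potential. Qed.

Lemma minimizer_equilibrium_fin : F \is a fin_num.
Proof.
rewrite ge0_fin_numE; last exact: integral_ge0.
rewrite /F ge0_integralD//; [|by move=> *; exact: potential_ge0|exact: measurable_potential].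
by have [? ?] := weighted_energy_lty mu_fin; exact: lte_add_pinfty.
Qed.

Lemma minimizer_le nu : nu (~` K) = 0 -> weighted_energy nu < +oo ->
  F <= \int[nu]_x g x.
Proof.
move=> nuK nufin; apply: minimizer_variation => // tau t _ tauE.
apply: mu_min; rewrite tauE ?muK ?nuK ?mule0 ?adde0//; exact: measurableC.
Qed.

Lemma minimizer_quasi_everywhere nu (D : set T) : measurable D ->
  nu (~` D) = 0 -> D `<=` K -> (forall x, D x -> g x < F) ->
  mutual_energy nu nu = +oo.
Proof.
move=> mD nuD DK gF.
have muD : nu D = 1.
  have := probability_setC nu mD; rewrite nuD => /esym/eqP.
  by rewrite sube_eq ?fin_num_measure ?add0e// => /eqP.
have intD f : measurable_fun setT f -> (forall x, 0 <= f x) ->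
    \int[nu]_x f x = \int[nu]_(x in D) f x.
  move=> mf f0; rewrite (@ge0_negligible_integral _ _ _ _ _ (~` D))//.
    by rewrite setDE setCK setTI.
  exact: measurableC.
have nuK : nu (~` K) = 0.
  apply: (@subset_measure0 _ _ _ _ _ (~` D)) => //; try exact: measurableC.
  exact: subsetC.
have Ffin := minimizer_equilibrium_fin.
have gle : \int[nu]_(x in D) g x <= F.
  rewrite (le_trans (y := \int[nu]_(x in D) F))//.
    apply: ge0_le_integral => //.
    - exact: measurable_funTS.
    - by move=> x /gF/ltW.
  by have := integral_cst nu mD F; rewrite /= muD mule1 => ->.
have [//|nufin] := eqVneq (mutual_energy nu nu) +oo; exfalso.
(* If [nu] has finite energy it is an admissible competitor, because [q <= g < F] on [D]. *)
have Jfin : weighted_energy nu < +oo.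
  have qF : \int[nu]_x q x <= F.
    rewrite intD// (le_trans _ gle)//; apply: ge0_le_integral => //.
    - exact: measurable_funTS.
    - exact: measurable_funTS.
    - by move=> x _; rewrite leeDr// potential_ge0.
  rewrite /weighted_energy; have := integral_ge0 nu (fun x _ => q0 x) : 0 <= \int[nu]_x q x.
  move: (mutual_energy_ge0 nu nu) nufin qF Ffin.
  move: (mutual_energy nu nu) (\int[nu]_x q x) F => [a| |] [b| |] [c| |]// *.
  by rewrite -EFinM -EFinD ltry.
have Fle := minimizer_le nuK Jfin.
rewrite intD// in Fle.
(* Minimality forces the mean of [g] over [D] to be [F], so the strictly positive function [F - g]
   has integral zero over a set of [nu]-mass 1. *)
have hint : \int[nu]_(x in D) (F - g x) <= 0.
  have : \int[nu]_(x in D) (g x + (F - g x)) = F.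
    rewrite (eq_integral (cst F)).
      by have := integral_cst nu mD F; rewrite /= muD mule1 => ->.
    move=> x.
    rewrite inE => /gF gx.
    rewrite addeC subeK//; have := g0 x; move: gx Ffin.
    by case: (g x) => [r| |]//; case: F.
  rewrite ge0_integralD//; last 3 first.
  - exact: measurable_funTS.
  - by move=> x /gF gx; apply: ltW; rewrite sube_gt0.
  - by apply: emeasurable_funB => //; exact: measurable_funTS.
  move: gle Fle Ffin; move: (\int[nu]_(x in D) g x) F => [a| |] [b| |]//.
  case: (\int[nu]_(x in D) _) => [c| |]//; rewrite !lee_fin => ab ba _ [] abE.
  by lra.
have mh : measurable_fun D (fun x => F - g x).
  by apply: emeasurable_funB => //; exact: measurable_funTS.
have h0 x : D x -> 0 < F - g x.
  by move=> /gF; rewrite sube_gt0.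
have : \int[nu]_(x in D) `|F - g x| = 0.
  apply/eqP; rewrite eq_le integral_ge0// andbT (le_trans _ hint)//.
  rewrite le_eqVlt; apply/orP; left; apply/eqP; apply: eq_integral => x.
  by rewrite inE => /h0/ltW/gee0_abs.
move/(ae_eq_integral_abs nu mD mh) => [N [mN N0 sub]].
have DN : D `<=` N.
  by move=> x Dx; apply: sub => /= /(_ Dx) h; have := h0 _ Dx; rewrite h ltxx.
have /eqP : nu D = 0 by exact: (subset_measure0 mD mN DN).
rewrite muD.
by rewrite onee_eq0.
Qed.

Lemma minimizer_on_support (N : set T) (a : \bar R) : measurable N ->
  0 < mu N -> F < a -> ~ (forall x, N x -> a <= g x).
Proof.
move=> mN N0 Fa gN.
have Ffin := minimizer_equilibrium_fin.
have mC : measurable (~` N) by exact: measurableC.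
have F0 : 0 <= F by exact: integral_ge0.
have split : F = \int[mu]_(x in N) g x + \int[mu]_(x in ~` N) g x.
  rewrite -ge0_integral_setU ?setUv//.
  by apply/disj_setPS; rewrite setICr.
have cge : F * mu (~` N) <= \int[mu]_(x in ~` N) g x.
  have [C0|C0'] := eqVneq (mu (~` N)) 0; first by rewrite C0 mule0 integral_ge0.
  have C0 : 0 < mu (~` N) by rewrite lt0e C0' measure_ge0.
  have [nu [nuA nuf]] := conditional_exists mC C0.
  set c := fine (mu (~` N)) in nuA nuf.
  have cE : mu (~` N) = c%:E by rewrite /c fineK// fin_num_measure.
  have c0 : (0 < c)%R by rewrite -lte_fin -cE.
  have dom f : measurable_fun setT f -> (forall x, 0 <= f x) ->
      \int[nu]_x f x <= c^-1%:E * \int[mu]_x f x.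
    move=> mf f0; rewrite nuf//; apply: lee_wpmul2l; first by rewrite lee_fin invr_ge0 ltW.
    by apply: ge0_subset_integral.
  have nuK : nu (~` K) = 0.
    rewrite nuA; last exact: measurableC.
    rewrite [X in _ * X](_ : _ = 0) ?mule0//.
    apply: (@subset_measure0 _ _ _ _ _ (~` K)) => //; try exact: measurableC.
    by apply: measurableI => //; exact: measurableC.
  have mufin := weighted_energy_lty mu_fin.
  have Jfin : weighted_energy nu < +oo.
    have : mutual_energy nu nu < +oo.
      apply: (dominated_energy_lty (c := c^-1%R) _ dom); last exact: mufin.1.
      by rewrite invr_ge0 ltW.
    have := dom q mq q0.
    have := integral_ge0 mu (fun x _ => q0 x) : 0 <= \int[mu]_x q x.
    have := integral_ge0 nu (fun x _ => q0 x) : 0 <= \int[nu]_x q x.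
    move: mufin.2 (mutual_energy_ge0 nu nu); rewrite /weighted_energy.
    move: (mutual_energy nu nu) (\int[mu]_x q x) (\int[nu]_x q x) => [r| |] [s| |] [t| |]// *.
    by rewrite -EFinM -EFinD ltry.
  have := minimizer_le nuK Jfin; rewrite nuf// cE => h.
  rewrite muleC -[leRHS](mul1e) -[1](_ : c%:E * c^-1%:E = 1); last by rewrite -EFinM divff// gt_eqF.
  by rewrite -muleA; apply: lee_wpmul2l => //; rewrite lee_fin ltW.
have nge : a * mu N <= \int[mu]_(x in N) g x.
  rewrite -integral_cst//; apply: ge0_le_integral => //.
  - by move=> x _; rewrite /= (le_trans F0)// ltW.
  - exact: measurable_funTS.
have : F * mu N < a * mu N by rewrite lte_pmul2r// fin_num_measure.
move=> /lt_le_trans/(_ nge).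
have : F = F * mu N + F * mu (~` N).
  rewrite -muleDr//; last by rewrite ge0_adde_def// inE.
  by rewrite probability_setC// addeCA subee ?fin_num_measure// adde0 mule1.
move: split cge Ffin.
have : mu N \is a fin_num by rewrite fin_num_measure.
have : mu (~` N) \is a fin_num by rewrite fin_num_measure.
move: (mu N) (mu (~` N)) => [x| |]// [y| |]//.
move: F (\int[mu]_(x in N) g x) (\int[mu]_(x in ~` N) g x) => [f| |]// [u| |]// [v| |]//= _ _ [].
move=> fE yv _ [fE'] fu.
have : (f * y <= v)%R by rewrite -lee_fin.
have : (f * x < u)%R by rewrite -lte_fin.
by move=> h1 h2; have := ltr_leD h1 h2; rewrite -fE -[X in (X < _)%R -> _]fE' ltxx.
Qed.

End Minimizer.
End Variation.

(** * Euclidean distance and the topology of the sphere *)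

Section Edist.
Variable R : realType.
Implicit Types x y z : pt3 R.

Lemma sqr_edist x y :
  edist x y ^+ 2 = (x.1.1 - y.1.1) ^+ 2 + (x.1.2 - y.1.2) ^+ 2 + (x.2 - y.2) ^+ 2.
Proof. by rewrite sqr_sqrtr// !addr_ge0 ?sqr_ge0. Qed.

Lemma edist_ge0 x y : 0 <= edist x y.
Proof. exact: sqrtr_ge0. Qed.

Lemma edistC x y : edist x y = edist y x.
Proof. by congr Num.sqrt; ring. Qed.

Lemma edist_eq0 x y : (edist x y == 0) = (x == y).
Proof.
apply/idP/eqP => [/eqP e0|->]; last first.
  by rewrite -[_ == _](sqrf_eq0 (edist y y)) sqr_edist !subrr expr0n/= !addr0.
have := sqr_edist x y; rewrite e0 expr0n/= => /esym/eqP.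
rewrite !paddr_eq0 ?addr_ge0 ?sqr_ge0// !sqrf_eq0 !subr_eq0.
by case: x y {e0} => [[a b] c] [[a' b'] c']/= /andP[/andP[/eqP-> /eqP->] /eqP->].
Qed.

Lemma edist_triangle y x z : edist x z <= edist x y + edist y z.
Proof.
rewrite -(@ler_pXn2r _ 2)// ?nnegrE ?addr_ge0 ?edist_ge0//.
rewrite sqrrD sqr_edist !sqr_edist.
(* The Cauchy-Schwarz inequality, by Lagrange's identity. *)
have CS (a b c a' b' c' r s : R) : 0 <= r -> 0 <= s ->
    r ^+ 2 = a ^+ 2 + b ^+ 2 + c ^+ 2 -> s ^+ 2 = a' ^+ 2 + b' ^+ 2 + c' ^+ 2 ->
    a * a' + b * b' + c * c' <= r * s.
  move=> r0 s0 rE sE; rewrite (le_trans (ler_norm _))//.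
  rewrite -(@ler_pXn2r _ 2)// ?nnegrE ?mulr_ge0// exprMn rE sE real_normK ?num_real//.
  rewrite -subr_ge0.
  rewrite [leRHS](_ : _ = (a * b' - b * a') ^+ 2 + (a * c' - c * a') ^+ 2 +
     (b * c' - c * b') ^+ 2); last by ring.
  by rewrite !addr_ge0 ?sqr_ge0.
have := CS _ _ _ _ _ _ _ _ (edist_ge0 x y) (edist_ge0 y z) (sqr_edist x y) (sqr_edist y z).
move: (edist x y) (edist y z) => r s h; nra.
Qed.

Lemma edist_coord x y e : edist x y < e ->
  [/\ `|x.1.1 - y.1.1| < e, `|x.1.2 - y.1.2| < e & `|x.2 - y.2| < e].
Proof.
move=> lt; have e0 : 0 <= e by rewrite (le_trans (edist_ge0 x y))// ltW.
have : edist x y ^+ 2 < e ^+ 2 by rewrite ltr_pXn2r// nnegrE edist_ge0.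
rewrite sqr_edist => h.
by split; rewrite -(@ltr_pXn2r _ 2)// ?nnegrE// real_normK ?num_real// (le_lt_trans _ h)//;
  have := sqr_ge0 (x.1.1 - y.1.1); have := sqr_ge0 (x.1.2 - y.1.2);
  have := sqr_ge0 (x.2 - y.2); lra.
Qed.

Lemma edist_lt_coord x y e : `|x.1.1 - y.1.1| < e -> `|x.1.2 - y.1.2| < e ->
  `|x.2 - y.2| < e -> edist x y < 2 * e.
Proof.
move=> h1 h2 h3; have e0 : 0 < e by rewrite (le_lt_trans _ h1).
rewrite -(@ltr_pXn2r _ 2)// ?nnegrE ?edist_ge0 ?mulr_ge0 ?ltW// sqr_edist exprMn.
have sq a : `|a| < e -> a ^+ 2 < e ^+ 2.
  by move=> h; rewrite -(@real_normK _ a) ?num_real// ltr_pXn2r// nnegrE ltW.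
have := sq _ h1; have := sq _ h2; have := sq _ h3; have := exprn_gt0 2 e0; lra.
Qed.

Lemma nbhs_edist x (U : set (pt3 R)) : nbhs x U ->
  exists2 e, 0 < e & forall y, edist y x < e -> U y.
Proof.
move=> /nbhs_ballP[e /= e0 eU]; exists e => // y /edist_coord[h1 h2 h3].
by apply: eU; split => //=; [split|]; rewrite /ball/= distrC.
Qed.

Lemma near_edist x e : 0 < e -> \forall y \near x, edist y x < e.
Proof.
move=> e0; apply/nbhs_ballP; exists (e / 2); first by rewrite /= divr_gt0.
move=> y [[h1 h2] h3]; rewrite [ltRHS](_ : _ = 2 * (e / 2)); last by field.
by apply: edist_lt_coord; rewrite distrC.
Qed.

Lemma open_edist_ball x e : open [set y | edist y x < e].
Proof.
rewrite openE => y /= yx; rewrite /interior.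
have := near_edist y (_ : 0 < e - edist y x); rewrite subr_gt0 => /(_ yx).
apply: filterS => z /= zy; rewrite (le_lt_trans (edist_triangle y _ _))//.
by rewrite -ltrBrDr.
Qed.

Lemma continuous_edist y : continuous (fun x => edist x y).
Proof.
move=> x; apply/cvgrPdist_lt => e e0; have := near_edist x e0.
apply: filterS => z zx; rewrite ltr_norml.
have := edist_triangle z x y; have := edist_triangle x z y.
rewrite (edistC x z); lra.
Qed.

(** Balls with rational centres and radii. They show that open sets lie in the product sigma-algebra
    and that the complement of a support is a countable union of null sets. *)
Lemma countable_base : exists B : nat -> set (pt3 R),
  (forall n, exists x e, B n = [set y | edist y x < e]) /\
  forall (U : set (pt3 R)) x, open U -> U x -> exists n, B n x /\ B n `<=` U.
Proof.
pose b (p : rat * rat * rat * rat) : set (pt3 R) :=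
  [set y | edist y ((ratr p.1.1.1, ratr p.1.1.2), ratr p.1.2) < ratr p.2].
pose B n : set (pt3 R) := b (odflt (0, 0, 0, 0) (unpickle n)).
exists B; split=> [n|U x oU Ux].
  by do 2 eexists; reflexivity.
have [r r0 rU] := nbhs_edist (open_nbhs_nbhs (conj oU Ux)).
(* Coordinates within [r / 8] put the rational centre within [r / 4] of [x]; a radius between
   [r / 4] and [r / 2] then contains [x] and stays in the ball of radius [r]. *)
have close (a : R) : exists p : rat, `|a - ratr p| < r / 8.
  have [|p] := @rat_in_itvoo _ (a - r / 8) (a + r / 8); first by lra.
  by rewrite in_itv/= => h; exists p; rewrite ltr_norml; lra.
have [p1 h1] := close x.1.1; have [p2 h2] := close x.1.2; have [p3 h3] := close x.2.
have [|p4] := @rat_in_itvoo _ (r / 4) (r / 2); first by lra.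
rewrite in_itv/= => /andP[h4 h5].
have xp : edist x ((ratr p1, ratr p2), ratr p3) < r / 4.
  by rewrite [ltRHS](_ : _ = 2 * (r / 8)); [exact: edist_lt_coord|field].
exists (pickle (p1, p2, p3, p4)); rewrite /B pickleK/=; split; rewrite /b/=.
  exact: lt_trans h4.
move=> y /= yp; apply: rU.
rewrite (le_lt_trans (edist_triangle ((ratr p1, ratr p2), ratr p3) _ _))//.
by rewrite (edistC _ x); lra.
Qed.

Lemma measurable_edist :
  measurable_fun setT (fun z : pt3 R * pt3 R => edist z.1 z.2).
Proof.
apply: measurableT_comp.
  by apply: continuous_measurable_fun; exact: sqrt_continuous.
have m11 : measurable_fun setT (fun z : pt3 R * pt3 R => z.1.1.1).
  by apply: measurableT_comp => //; apply: measurableT_comp.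
have m12 : measurable_fun setT (fun z : pt3 R * pt3 R => z.1.1.2).
  by apply: measurableT_comp => //; apply: measurableT_comp.
have m13 : measurable_fun setT (fun z : pt3 R * pt3 R => z.1.2).
  by apply: measurableT_comp => //; apply: measurableT_comp.
have m21 : measurable_fun setT (fun z : pt3 R * pt3 R => z.2.1.1).
  by apply: measurableT_comp => //; apply: measurableT_comp.
have m22 : measurable_fun setT (fun z : pt3 R * pt3 R => z.2.1.2).
  by apply: measurableT_comp => //; apply: measurableT_comp.
have m23 : measurable_fun setT (fun z : pt3 R * pt3 R => z.2.2).
  by apply: measurableT_comp => //; apply: measurableT_comp.
by apply: measurable_funD; [apply: measurable_funD|]; apply: measurable_funX;
  exact: measurable_funB.
Qed.

Lemma measurable_edistr x : measurable_fun setT (edist x).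
Proof.
rewrite (_ : edist x = (fun z : pt3 R * pt3 R => edist z.1 z.2) \o (fun y => (x, y)))//.
exact: (measurableT_comp measurable_edist (pair1_measurable x)).
Qed.

Lemma measurable_edist_ball x e : measurable [set y | edist y x < e].
Proof.
have := measurable_edistr x measurableT (measurable_itv `]-oo, e[%R).
rewrite setTI; congr measurable; apply/seteqP; split => y /=;
  by rewrite in_itv/= edistC.
Qed.

Lemma open_measurable3 (U : set (pt3 R)) : open U -> measurable U.
Proof.
move=> oU; have [B [Bb BU]] := countable_base.
have -> : U = \bigcup_n (if `[< B n `<=` U >] then B n else set0).
  apply/seteqP; split=> [x Ux|x [n _]].
    have [n [Bx sub]] := BU _ _ oU Ux; exists n => //.
    by case: asboolP.
  by case: asboolP => // sub; exact: sub.
apply: bigcupT_measurable => n; case: asboolP => // _.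
by have [x [e ->]] := Bb n; exact: measurable_edist_ball.
Qed.

Lemma closed_measurable3 (U : set (pt3 R)) : closed U -> measurable U.
Proof.
move=> cU; rewrite -(setCK U); apply: measurableC; apply: open_measurable3.
exact: closed_openC.
Qed.

Lemma supp_null (mu : probability (pt3 R) R) : mu (~` supp mu) = 0%E.
Proof.
have [B [Bb BU]] := countable_base.
have mB n : measurable (B n).
  by have [x [e ->]] := Bb n; exact: measurable_edist_ball.
have oB n : open (B n) by have [x [e ->]] := Bb n; exact: open_edist_ball.
pose N n := if mu (B n) == 0%E then B n else set0.
have mN n : measurable (N n) by rewrite /N; case: ifP.
have -> : ~` supp mu = \bigcup_n N n.
  apply/seteqP; split=> [x /existsNP[U /not_implyP[oU /not_implyP[Ux U0]]]|x [n _]].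
    have [n [Bx sub]] := BU _ _ oU Ux; exists n => //; rewrite /N.
    case: ifPn => // /negP[]; rewrite eq_le measure_ge0 andbT.
    rewrite (@le_trans _ _ (mu U))//; first by rewrite le_measure// inE//; exact: open_measurable3.
    by rewrite leNgt; apply/negP.
  rewrite /N; case: ifPn => // /eqP B0 Bx /(_ _ (oB n) Bx).
  by rewrite B0 ltxx.
have mU : measurable (\bigcup_n N n) by exact: bigcupT_measurable.
apply/(negligibleP mu mU); apply: negligible_bigcup => n; apply/(negligibleP mu (mN n)).
by rewrite /N; case: ifPn => [/eqP//|_]; exact: measure0.
Qed.

Lemma closed_supp (mu : probability (pt3 R) R) : closed (supp mu).
Proof.
rewrite -openC openE => x /existsNP[U /not_implyP[oU /not_implyP[Ux U0]]].
have := open_nbhs_nbhs (conj oU Ux); apply: filterS => y Uy sy.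
exact: U0 (sy U oU Uy).
Qed.

Lemma supp_sub (mu : probability (pt3 R) R) (K : set (pt3 R)) :
  closed K -> prob_on K mu -> supp mu `<=` K.
Proof.
move=> cK muK x sx; apply: contrapT => Kx.
have := sx (~` K) (closed_openC cK) Kx.
by rewrite muK ltxx.
Qed.

Lemma closed_sphereS : closed (@sphereS R).
Proof.
have -> : @sphereS R = (fun x => edist x ((0, 0), 2^-1)) @^-1` [set 2^-1].
  apply/seteqP; split => x /=; rewrite /sphereS/=.
    rewrite /edist/= !subr0 => ->.
    have -> : 4^-1 = (2^-1 : R) ^+ 2 by field.
    by rewrite sqrtr_sqr ger0_norm// invr_ge0.
  move=> h; have := sqr_edist x ((0, 0), 2^-1); rewrite h/= !subr0 => <-; by field.
apply: (@preimage_closed _ _ (fun x : R * R * R => edist x ((0, 0), 2^-1)) [set 2^-1 : R]).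
  by move=> x _; exact: continuous_edist.
exact: closed_eq.
Qed.

Lemma compact_sphereS : compact (@sphereS R).
Proof.
pose I : set R := `[-1, 1]%classic.
apply: (@subclosed_compact _ _ (I `*` I `*` I : set (R * R * R))).
- exact: closed_sphereS.
- by apply: compact_setX; [apply: compact_setX|]; exact: segment_compact.
- move=> x; rewrite /sphereS/= => h; rewrite /I/= !in_itv/=.
  have := sqr_ge0 x.1.1; have := sqr_ge0 x.1.2; have := sqr_ge0 (x.2 - 2^-1).
  by split; [split|]; apply/andP; split; nra.
Qed.

Lemma edist_sphere_le1 x y : sphereS x -> sphereS y -> edist x y <= 1.
Proof.
rewrite /sphereS/= => hx hy.
rewrite -(@ler_pXn2r _ 2)// ?nnegrE ?edist_ge0// expr1n sqr_edist.
(* Parallelogram law about the centre [m]: [|x - y|^2 + |x + y - 2 m|^2 = 1]. *)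
have := sqr_ge0 (x.1.1 + y.1.1); have := sqr_ge0 (x.1.2 + y.1.2).
have := sqr_ge0 (x.2 + y.2 - 1).
by nra.
Qed.

End Edist.

(** * Logarithmic kernel and potentials *)

Section LogKernel.
Variable R : realType.
Implicit Types (x y z : pt3 R) (mu nu : probability (pt3 R) R).

(* On the sphere, of diameter 1, the logarithmic kernel is already nonnegative. *)
Definition logk (z : pt3 R * pt3 R) : \bar R := maxe 0%E (lker z.1 z.2).

Lemma lkerE x y :
  lker x y = if edist x y == 0 then +oo%E else (- ln (edist x y))%:E.
Proof. by rewrite /lker edist_eq0. Qed.

Lemma logkE x y : logk (x, y) =
  if edist x y == 0 then +oo%E else (Num.max 0 (- ln (edist x y)))%:E.
Proof.
rewrite /logk/= lkerE; case: ifPn => _; last by rewrite EFin_max.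
by rewrite max_r// leey.
Qed.

Lemma logk_ge0 (z : pt3 R * pt3 R) : (0 <= logk z)%E.
Proof. by rewrite /logk le_max lexx. Qed.

Lemma logk_sym x y : logk (x, y) = logk (y, x).
Proof. by rewrite !logkE edistC. Qed.

Lemma measurable_lker :
  measurable_fun setT (fun z : pt3 R * pt3 R => lker z.1 z.2).
Proof.
under eq_fun do rewrite lkerE.
apply: measurable_fun_ifT => //.
- by apply: measurable_fun_eqr => //; exact: measurable_edist.
- apply/measurable_EFinP; apply: measurable_funN.
  by apply: measurableT_comp; [exact: measurable_ln|exact: measurable_edist].
Qed.

Lemma measurable_logk : measurable_fun setT logk.
Proof. by apply: measurable_maxe => //; exact: measurable_lker. Qed.

Lemma logk_ge x y (t : R) : 0 < t -> edist x y <= t ->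
  ((Num.max 0 (- ln t))%:E <= logk (x, y))%E.
Proof.
move=> t0 xyt; rewrite logkE; case: ifPn => [_|e0]; first by rewrite leey.
have {}e0 : 0 < edist x y by rewrite lt0r e0 edist_ge0.
rewrite lee_fin ge_max le_max lexx/= le_max; apply/orP; right.
by rewrite lerN2 ler_ln.
Qed.

Lemma logk_sphere x y : sphereS x -> sphereS y -> logk (x, y) = lker x y.
Proof.
move=> Sx Sy; rewrite /logk/= max_r// lkerE; case: ifPn => // _.
by rewrite lee_fin oppr_ge0 ln_le0// edist_sphere_le1.
Qed.

(** Taking logarithms turns the ratio [c] into an additive error; the truncation at 0 is harmless
    because [ln c >= 0]. All regularity estimates for potentials rest on such comparisons of
    distances. *)
Lemma logk_comparison x x' y (c : R) : 1 <= c -> edist x' y <= c * edist x y ->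
  (logk (x, y) <= logk (x', y) + (ln c)%:E)%E.
Proof.
move=> c1 h; have c0 : 0 < c by exact: lt_le_trans c1.
have lc : 0 <= ln c by exact: ln_ge0.
have [e0|e0] := eqVneq (edist x' y) 0.
  by rewrite [logk (x', y)]logkE e0 eqxx addye// leey.
have {}e0 : 0 < edist x' y by rewrite lt0r e0 edist_ge0.
have e1 : 0 < edist x y by rewrite -(pmulr_rgt0 _ c0) (lt_le_trans e0).
rewrite !logkE !gt_eqF// -EFinD lee_fin ge_max addr_ge0 ?le_max ?lexx//=.
rewrite -lerBlDr le_max; apply/orP; right.
by rewrite -opprD lerN2 addrC -lnM ?posrE// ler_ln ?posrE ?mulr_gt0.
Qed.

Local Notation pot := (potential logk).

Lemma measurable_pot mu : measurable_fun setT (pot mu).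
Proof. by apply: measurable_potential; [exact: measurable_logk|exact: logk_ge0]. Qed.

Lemma pot_ge0 mu x : (0 <= pot mu x)%E.
Proof. by apply: potential_ge0; exact: logk_ge0. Qed.

Lemma measurable_logkr x : measurable_fun setT (fun y => logk (x, y)).
Proof. by apply: measurable_kernel; exact: measurable_logk. Qed.

Lemma pot_comparison mu x x' (D : set (pt3 R)) (h : pt3 R -> \bar R) :
  measurable D -> mu (~` D) = 0%E -> measurable_fun setT h ->
  (forall y, 0 <= h y)%E ->
  (forall y, D y -> logk (x, y) <= logk (x', y) + h y)%E ->
  (pot mu x <= pot mu x' + \int[mu]_y h y)%E.
Proof.
move=> mD D0 mh h0 le; rewrite /potential -ge0_integralD//; last 2 first.
- by move=> y _; exact: logk_ge0.
- exact: measurable_logkr.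
apply: ae_ge0_le_integral => //.
- by move=> y _; exact: logk_ge0.
- exact: measurable_logkr.
- by move=> y _; rewrite adde_ge0// logk_ge0.
- by apply: emeasurable_funD => //; exact: measurable_logkr.
exists (~` D); split => //; first exact: measurableC.
by apply: subsetC => y Dy /= _; exact: le.
Qed.

Lemma integral_cst_probability mu (r : \bar R) : (\int[mu]_y r = r)%E.
Proof. by have := integral_cst mu measurableT r; rewrite /= probability_setT mule1. Qed.

Lemma pot_comparison_cst mu x x' (D : set (pt3 R)) (c : R) :
  measurable D -> mu (~` D) = 0%E -> 1 <= c ->
  (forall y, D y -> edist x' y <= c * edist x y) ->
  (pot mu x <= pot mu x' + (ln c)%:E)%E.
Proof.
move=> mD D0 c1 le; rewrite -[(ln c)%:E](integral_cst_probability mu).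
apply: (pot_comparison mD) => //.
- by move=> y; rewrite lee_fin ln_ge0.
- by move=> y Dy; apply: logk_comparison => //; exact: le.
Qed.

(** The kernel is at least [- ln r] on the ball. Read backwards, a bounded potential forces small
    balls to have small mass. *)
Lemma pot_ball mu y (r : R) : 0 < r ->
  ((- ln r)%:E * mu [set z | (edist z y < r)%R] <= pot mu y)%E.
Proof.
move=> r0; have mB := measurable_edist_ball y r.
have [l0|l0] := leP (- ln r) 0.
  by rewrite (le_trans _ (pot_ge0 _ _))// mule_le0_ge0// lee_fin.
rewrite -(integral_cst mu mB)/=.
rewrite (@le_trans _ _ (\int[mu]_(z in [set z | (edist z y < r)%R]) logk (y, z))%E)//.
  apply: ge0_le_integral => //.
  - by move=> z _; rewrite lee_fin ltW.
  - by apply: measurable_funTS; exact: measurable_logkr.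
  - move=> z /= zy; rewrite logk_sym (le_trans _ (logk_ge r0 (ltW zy)))//.
    by rewrite lee_fin le_max lexx orbT.
apply: ge0_subset_integral => //; first exact: measurable_logkr.
by move=> *; exact: logk_ge0.
Qed.

(** Bounded kernels increasing to [logk]: adding [n.+1%:R^-1] to the distance removes the
    singularity. *)
Let kn (n : nat) x y : \bar R :=
  (Num.max 0 (- ln (edist x y + n.+1%:R^-1)))%:E.

Let edist_kn_gt0 (n : nat) x y : 0 < edist x y + n.+1%:R^-1.
Proof. by rewrite ltr_wpDl ?edist_ge0// invr_gt0. Qed.

Let kn_le_logk n x y : (kn n x y <= logk (x, y))%E.
Proof. by apply: logk_ge => //; rewrite lerDl invr_ge0. Qed.

Let kn_nd x y : {homo kn ^~ x ^~ y : n m / (n <= m)%N >-> (n <= m)%E}.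
Proof.
move=> n m nm; rewrite lee_fin ge_max le_max lexx/= le_max; apply/orP; right.
by rewrite lerN2 ler_ln ?posrE// lerD2l lef_pV2 ?posrE// ler_nat.
Qed.

Let kn_lim x y : limn (fun n => kn n x y) = logk (x, y).
Proof.
have cv := ereal_nondecreasing_cvgn (@kn_nd x y).
rewrite (cvg_lim _ cv)//; apply/eqP; rewrite eq_le; apply/andP; split.
  by apply: ub_ereal_sup => _ [n _ <-]; exact: kn_le_logk.
set s := ereal_sup _; rewrite leNgt; apply/negP => lt.
have sn n : (kn n x y <= s)%E by apply: ereal_sup_ubound; exists n.
have := sn 0%N; move: lt sn; case: s => [b| |] lt sn h0; last 2 first.
- by move: lt; rewrite ltNge leey.
- by move: h0; rewrite leNgt ltNyr.
have b0 : 0 <= b by rewrite -lee_fin (le_trans _ h0)// lee_fin le_max lexx.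
(* If the supremum were a real [b < logk (x, y)], the distance would be below [expR (- b)], with
   room left to add [n.+1%:R^-1] for a large [n]. *)
have eb : edist x y < expR (- b).
  move: lt; rewrite logkE; case: ifPn => [/eqP->|e0]; first by rewrite expR_gt0.
  rewrite lte_fin lt_max ltNge b0/= => bl.
  have ep : 0 < edist x y by rewrite lt0r e0 edist_ge0.
  by rewrite -[ltLHS]lnK// ltr_expR ltrNr.
have [n] : exists n : nat, n.+1%:R^-1 < expR (- b) - edist x y.
  have d0 : 0 < expR (- b) - edist x y by rewrite subr_gt0.
  by have [n _ /(_ n (leqnn n))/= ?] := near_infty_natSinv_lt (PosNum d0); exists n.
rewrite ltrBrDl => nb; have := sn n; rewrite lee_fin ge_max => /andP[_].
rewrite leNgt => /negP; apply.
by rewrite ltrNr -[ltRHS](expRK (- b)) ltr_ln ?posrE ?expR_gt0.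
Qed.

Let measurable_kn n x : measurable_fun setT (kn n x).
Proof.
apply/measurable_EFinP; apply: measurable_maxr => //; apply: measurable_funN.
apply: measurableT_comp; first exact: measurable_ln.
by apply: measurable_funD => //; exact: measurable_edistr.
Qed.

(** With [r = n.+1%:R^-1] and [d = edist x x'], [|x' - y| <= |x - y| + d <= (1 + d / r) * (|x - y| +
    r)], and [ln (1 + d / r) <= d / r]. The error does not depend on [y], so it survives
    integration. *)
Let kn_shift n x x' y :
  (kn n x y <= logk (x', y) + (edist x x' * n.+1%:R)%:E)%E.
Proof.
have r0 : (0 : R) < n.+1%:R^-1 by rewrite invr_gt0.
set r : R := n.+1%:R^-1 in r0 *.
have e0 : 0 < edist x y + r by exact: edist_kn_gt0.
have d0 := edist_ge0 x x'.
have rV : n.+1%:R = r^-1 by rewrite invrK.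
have t0 : 0 < 1 + edist x x' / r by rewrite ltr_pwDl// divr_ge0// ltW.
have le : edist x' y <= (1 + edist x x' / r) * (edist x y + r).
  have := edist_triangle x x' y; rewrite (edistC x' x) => h.
  have dr : edist x x' / r * r = edist x x' by rewrite divfK// gt_eqF.
  have q0 : 0 <= edist x x' / r * edist x y by rewrite mulr_ge0 ?edist_ge0// divr_ge0// ltW.
  rewrite (le_trans h)// mulrDl mul1r mulrDr dr; lra.
apply: (@le_trans _ _
  ((Num.max 0 (- ln ((1 + edist x x' / r) * (edist x y + r))))%:E + (edist x x' / r)%:E)%E).
  rewrite -EFinD lee_fin ge_max; apply/andP; split.
    by rewrite addr_ge0 ?divr_ge0// ?le_max ?lexx// ltW.
  rewrite lnM ?posrE// -lerBlDr le_max; apply/orP; right.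
  rewrite opprD addrC lerD2r lerN2; apply: le_ln1Dx.
  by rewrite (lt_le_trans (ltrN10 R))// divr_ge0// ltW.
rewrite rV; apply: leeD => //; apply: logk_ge => //; exact: mulr_gt0.
Qed.

(** By monotone convergence some regularized potential at [x] already exceeds [a]; by [kn_shift] it
    bounds the full potential at nearby points from below. *)
Lemma pot_lsc mu x (a : R) : (a%:E < pot mu x)%E ->
  \forall x' \near x, (a%:E < pot mu x')%E.
Proof.
move=> ax.
have mono : (\int[mu]_y kn n x y)%E @[n --> \oo] --> pot mu x.
  have -> : pot mu x = (\int[mu]_y limn (fun n => kn n x y))%E.
    by apply: eq_integral => y _; rewrite kn_lim.
  apply: cvg_monotone_convergence => //.
  - by move=> n y _; rewrite lee_fin le_max lexx.
have [n an] : exists n, (a%:E < \int[mu]_y kn n x y)%E.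
  apply: contrapT => /forallNP h; move: ax; apply/negP; rewrite -leNgt.
  rewrite -(cvg_lim _ mono)//; apply: lime_le.
    by apply/cvg_ex; exists (pot mu x).
  by apply: nearW => n; rewrite leNgt; apply/negP.
have key x' : (\int[mu]_y kn n x y <= pot mu x' + (edist x x' * n.+1%:R)%:E)%E.
  rewrite -[(_ * _)%:E](integral_cst_probability mu) -ge0_integralD//; last 3 first.
  - by move=> y _; exact: logk_ge0.
  - exact: measurable_logkr.
  - by move=> y _; rewrite lee_fin mulr_ge0// edist_ge0.
  apply: ge0_le_integral => //.
  - by move=> y _; rewrite lee_fin le_max lexx.
  - by apply: emeasurable_funD => //; exact: measurable_logkr.
have [e e0 ae] : exists2 e : R, 0 < e & (a%:E + (e * n.+1%:R)%:E < \int[mu]_y kn n x y)%E.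
  have n0 : (0 : R) < n.+1%:R by rewrite ltr0n.
  move: an; case: (\int[mu]_y kn n x y)%E => [b| |]//.
    rewrite lte_fin => ab; exists ((b - a) / 2 / n.+1%:R).
      by rewrite !divr_gt0// subr_gt0.
    by rewrite divfK ?gt_eqF// -EFinD lte_fin; lra.
  by move=> _; exists 1 => //; rewrite -EFinD ltry.
have := near_edist x e0; apply: filterS => x' x'x.
rewrite ltNge; apply/negP => le; have := lt_le_trans ae (key x').
apply/negP; rewrite -leNgt; apply: leeD => //.
by rewrite lee_fin ler_pM2r ?ltr0n// edistC; exact: ltW.
Qed.

Lemma Upot_pot mu x : prob_on (@sphereS R) mu -> sphereS x -> Upot mu x = pot mu x.
Proof.
move=> muS Sx; have mS := closed_measurable3 (@closed_sphereS R).
apply: ae_eq_integral => //.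
- exact: (measurable_kernel measurable_lker).
- exact: measurable_logkr.
exists (~` sphereS (R := R)); split => //; first exact: measurableC.
by apply: subsetC => y Sy /= _; rewrite logk_sphere.
Qed.

Lemma measurable_Upot mu : measurable_fun setT (Upot mu).
Proof.
(* [lker] changes sign on the whole space, so Tonelli's theorem is applied to its positive and
   negative parts separately. *)
pose lp := (fun z : pt3 R * pt3 R => lker z.1 z.2).
have -> : Upot mu = (fun x => potential lp^\+%E mu x - potential lp^\-%E mu x)%E.
  apply/funext => x; rewrite /Upot integralE /potential /=.
  congr (_ - _)%E; apply: eq_integral => y _; by rewrite ?funeposE ?funenegE.
apply: emeasurable_funB; apply: measurable_potential => //.
- by apply: measurable_funepos; exact: measurable_lker.
- by apply: measurable_funeneg; exact: measurable_lker.
Qed.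

Lemma energy_mutual mu : prob_on (@sphereS R) mu ->
  energy mu = mutual_energy logk mu mu.
Proof.
move=> muS; have mS := closed_measurable3 (@closed_sphereS R).
apply: ae_eq_integral => //.
- exact: measurable_Upot.
- exact: measurable_pot.
exists (~` sphereS (R := R)); split => //; first exact: measurableC.
by apply: subsetC => y Sy /= _; exact: Upot_pot.
Qed.

End LogKernel.

(** * Small squares on the sphere *)

Section FourPoints.
Variable R : realType.
Implicit Types x y : pt3 R.

(* the scalar product of the outward unit normals of the sphere at [x] and [y] *)
Definition ndot x y : R :=
  4 * (x.1.1 * y.1.1 + x.1.2 * y.1.2 + (x.2 - 2^-1) * (y.2 - 2^-1)).

Lemma sqr_edist_ndot x y : sphereS x -> sphereS y ->
  2 * edist x y ^+ 2 = 1 - ndot x y.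
Proof. by rewrite /sphereS /ndot sqr_edist/= => hx hy; lra. Qed.

(* v and w are the images of two axes under the Householder reflection exchanging
   the third axis and the direction of -n *)
Lemma tangent_frame (n1 n2 n3 : R) : n1 ^+ 2 + n2 ^+ 2 + n3 ^+ 2 = 1 ->
  exists v1 v2 v3 w1 w2 w3 : R,
  [/\ v1 ^+ 2 + v2 ^+ 2 + v3 ^+ 2 = 1 /\ w1 ^+ 2 + w2 ^+ 2 + w3 ^+ 2 = 1,
      n1 * v1 + n2 * v2 + n3 * v3 = 0, n1 * w1 + n2 * w2 + n3 * w3 = 0 &
      forall a b c : R, (n1 * a + n2 * b + n3 * c) ^+ 2 +
        (v1 * a + v2 * b + v3 * c) ^+ 2 + (w1 * a + w2 * b + w3 * c) ^+ 2 =
        a ^+ 2 + b ^+ 2 + c ^+ 2].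
Proof.
move=> hn; have [n30|n30] := eqVneq (1 + n3) 0.
  have n3E : n3 = -1 by lra.
  have n12 : n1 ^+ 2 + n2 ^+ 2 = 0 by rewrite n3E in hn; lra.
  have /eqP := n12; rewrite paddr_eq0 ?sqr_ge0// !sqrf_eq0 => /andP[/eqP n1E /eqP n2E].
  exists 1, 0, 0, 0, 1, 0; rewrite n1E n2E n3E; split; [split| | |] => *; ring.
pose t := (1 + n3)^-1.
(* [f] and [g] are the relations satisfied by the unit vector and by [t]; each identity below is
   written as a polynomial combination of them. *)
pose f := n1 ^+ 2 + n2 ^+ 2 + n3 ^+ 2 - 1; have f0 : f = 0 by rewrite /f hn subrr.
pose g := t * (1 + n3) - 1; have g0 : g = 0 by rewrite /g mulVf// subrr.
exists (1 - n1 * t * n1), (- (n1 * t * n2)), (- (n1 * t * (1 + n3))).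
exists (- (n2 * t * n1)), (1 - n2 * t * n2), (- (n2 * t * (1 + n3))).
split.
- split.
    transitivity (1 + n1 ^+ 2 * (t ^+ 2 * f + 2 * t * g)); first by rewrite /f /g; ring.
    by rewrite f0 g0; ring.
  transitivity (1 + n2 ^+ 2 * (t ^+ 2 * f + 2 * t * g)); first by rewrite /f /g; ring.
  by rewrite f0 g0; ring.
- transitivity (- n1 * (t * f + g)); first by rewrite /f /g; ring.
  by rewrite f0 g0; ring.
- transitivity (- n2 * (t * f + g)); first by rewrite /f /g; ring.
  by rewrite f0 g0; ring.
- move=> a b c; pose s := n1 * a + n2 * b + (1 + n3) * c.
  pose m := n1 * a + n2 * b + n3 * c.
  transitivity (a ^+ 2 + b ^+ 2 + c ^+ 2 + s ^+ 2 * t ^+ 2 * f +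
    g * (2 * t * s ^+ 2 - 2 * s * m - g * s ^+ 2)); first by rewrite /f /g /s /m; ring.
  by rewrite f0 g0; ring.
Qed.

(** The vertices are obtained by turning the normal at [x0] by the angle with cosine [C] and sine
    [S] towards two orthogonal tangent directions and their opposites. [a] and [b] are the
    components of the normal at [y] along these directions, whence Pythagoras' relation. *)
Lemma square_on_sphere x0 (C S : R) : sphereS x0 -> C ^+ 2 + S ^+ 2 = 1 ->
  exists x1 x2 x3 x4 : pt3 R,
  [/\ sphereS x1, sphereS x2, sphereS x3 & sphereS x4] /\
  forall y, sphereS y -> exists a b : R,
    [/\ a ^+ 2 + b ^+ 2 = 1 - ndot x0 y ^+ 2,
        ndot x1 y = C * ndot x0 y + S * a, ndot x2 y = C * ndot x0 y - S * a,
        ndot x3 y = C * ndot x0 y + S * b & ndot x4 y = C * ndot x0 y - S * b].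
Proof.
case: x0 => [[m1 m2] m3]; rewrite /sphereS/= => h hC.
have hn : (2 * m1) ^+ 2 + (2 * m2) ^+ 2 + (2 * m3 - 1) ^+ 2 = 1 by lra.
have [v1 [v2 [v3 [w1 [w2 [w3 [[vv ww] nv nw P]]]]]]] := tangent_frame hn.
pose X (s u1 u2 u3 : R) : pt3 R :=
  ((C * m1 + s * u1 / 2, C * m2 + s * u2 / 2), 2^-1 + C * (m3 - 2^-1) + s * u3 / 2).
have SX (s u1 u2 u3 : R) : s ^+ 2 = S ^+ 2 -> u1 ^+ 2 + u2 ^+ 2 + u3 ^+ 2 = 1 ->
    2 * m1 * u1 + 2 * m2 * u2 + (2 * m3 - 1) * u3 = 0 -> sphereS (X s u1 u2 u3).
  move=> sE uE nu; rewrite /sphereS/X/=.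
  transitivity (C ^+ 2 / 4 * ((2 * m1) ^+ 2 + (2 * m2) ^+ 2 + (2 * m3 - 1) ^+ 2) +
     C * s / 2 * (2 * m1 * u1 + 2 * m2 * u2 + (2 * m3 - 1) * u3) +
     s ^+ 2 / 4 * (u1 ^+ 2 + u2 ^+ 2 + u3 ^+ 2)); first by field.
  by rewrite hn nu uE sE; lra.
have nX (s u1 u2 u3 : R) y : ndot (X s u1 u2 u3) y = C * ndot ((m1, m2), m3) y +
    s * (u1 * (2 * y.1.1) + u2 * (2 * y.1.2) + u3 * (2 * y.2 - 1)).
  by rewrite /ndot /X/=; field.
have S2 : (- S) ^+ 2 = S ^+ 2 by rewrite sqrrN.
exists (X S v1 v2 v3), (X (- S) v1 v2 v3), (X S w1 w2 w3), (X (- S) w1 w2 w3).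
split; first by split; apply: SX.
move=> y hy; exists (v1 * (2 * y.1.1) + v2 * (2 * y.1.2) + v3 * (2 * y.2 - 1)),
  (w1 * (2 * y.1.1) + w2 * (2 * y.1.2) + w3 * (2 * y.2 - 1)).
rewrite !nX !mulNr; split => //.
have := P (2 * y.1.1) (2 * y.1.2) (2 * y.2 - 1).
rewrite (_ : 2 * m1 * (2 * y.1.1) + 2 * m2 * (2 * y.1.2) + (2 * m3 - 1) * (2 * y.2 - 1) =
  ndot ((m1, m2), m3) y); last by rewrite /ndot/=; field.
rewrite (_ : (2 * y.1.1) ^+ 2 + (2 * y.1.2) ^+ 2 + (2 * y.2 - 1) ^+ 2 = 1); last first.
  by move: hy; rewrite /sphereS/= => hy; lra.
by move=> e; rewrite -[X in _ = X - _]e; ring.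
Qed.

(* [prod edist x_j y] against [edist x0 y ^+ 4] for the vertices [x_j] of a small
   square centred at [x0]: both bounds agree to first order in [h = 1 - cos]. *)
Lemma square_product_bounds x0 (h : R) : sphereS x0 -> 0 < h < 1 ->
  exists x1 x2 x3 x4 : pt3 R,
  [/\ sphereS x1, sphereS x2, sphereS x3 & sphereS x4] /\
  forall y (k : R), sphereS y -> 0 < k -> 1 <= 4 * k * edist x0 y ^+ 4 ->
    let p := edist x1 y * edist x2 y * (edist x3 y * edist x4 y) in
    edist x0 y ^+ 4 * (1 - h - k * h ^+ 2) <= p /\
    p ^+ 2 <= edist x0 y ^+ 8 * ((1 - h + k * h ^+ 2) ^+ 2 + k ^+ 2 * h ^+ 2).
Proof.
move=> S0 /andP[h0 h1].
pose C := 1 - h; pose S := Num.sqrt (1 - C ^+ 2).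
have C2 : 0 <= 1 - C ^+ 2 by rewrite /C; nra.
have CS : C ^+ 2 + S ^+ 2 = 1 by rewrite /S sqr_sqrtr//; lra.
have [x1 [x2 [x3 [x4 [[S1 S2 S3 S4] H]]]]] := square_on_sphere S0 CS.
exists x1, x2, x3, x4; split => // y k Sy k0 kd p.
have [a [b [ab e1 e2 e3 e4]]] := H y Sy.
have d0 := sqr_edist_ndot S0 Sy.
have := sqr_edist_ndot S1 Sy; have := sqr_edist_ndot S2 Sy.
have := sqr_edist_ndot S3 Sy; have := sqr_edist_ndot S4 Sy.
rewrite e1 e2 e3 e4 => f4 f3 f2 f1.
set q := ndot x0 y in ab d0 f1 f2 f3 f4.
have D0 : 0 <= 1 - q by rewrite -d0 mulr_ge0// sqr_ge0.
set D := 1 - q in D0 d0.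
have E4 : edist x0 y ^+ 4 = D ^+ 2 / 4.
  by rewrite -d0; field.
have E8 : edist x0 y ^+ 8 = D ^+ 4 / 16.
  by rewrite -d0; field.
(* The lower bound on the distance from [x0] to [y] lets absolute errors of order [h ^+ 2] be
   absorbed as relative errors [k * h ^+ 2]. *)
have kD : 1 <= k * D ^+ 2 by move: kd; rewrite E4; lra.
have q1 : q ^+ 2 <= 1 by have := sqr_ge0 a; have := sqr_ge0 b; lra.
have ql : -1 <= q <= 1 by apply/andP; split; nra.
have p0 : 0 <= p by rewrite /p !mulr_ge0// edist_ge0.
(* Opposite vertices multiply to a difference of squares, and [a ^+ 2 + b ^+ 2 = 1 - q ^+ 2] turns
   the whole product into a sum of two squares. Dropping the second gives the lower bound;
   estimating both gives the upper one. *)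
have pE : (4 * p) ^+ 2 = (C * D ^+ 2 - q * h ^+ 2) ^+ 2 + (S ^+ 2 * a * b) ^+ 2.
  transitivity (2 * edist x1 y ^+ 2 * (2 * edist x2 y ^+ 2) *
    (2 * edist x3 y ^+ 2 * (2 * edist x4 y ^+ 2))); first by rewrite /p; ring.
  rewrite f1 f2 f3 f4.
  have bE : b ^+ 2 = 1 - q ^+ 2 - a ^+ 2 by lra.
  have SE : S ^+ 2 = 1 - C ^+ 2 by lra.
  transitivity (((1 - C * q) ^+ 2 - S ^+ 2 * a ^+ 2) * ((1 - C * q) ^+ 2 - S ^+ 2 * b ^+ 2)).
    by ring.
  transitivity ((C * D ^+ 2 - q * h ^+ 2) ^+ 2 + S ^+ 2 * S ^+ 2 * a ^+ 2 * b ^+ 2); last by ring.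
  by rewrite bE SE /D /C; ring.
clearbody p.
have p4 : 0 <= 4 * p by rewrite mulr_ge0.
have h2 : 0 <= h ^+ 2 by exact: sqr_ge0.
have kh : h ^+ 2 <= k * D ^+ 2 * h ^+ 2 by rewrite ler_peMl.
have D2 : 0 <= D ^+ 2 by exact: sqr_ge0.
split.
  rewrite E4.
  have lo : C * D ^+ 2 - q * h ^+ 2 <= 4 * p.
    rewrite (le_trans (ler_norm _))// -(@ler_pXn2r _ 2)// ?nnegrE//.
    by rewrite pE real_normK ?num_real// lerDl sqr_ge0.
  have : q * h ^+ 2 <= h ^+ 2 by rewrite ler_piMl//; case/andP: ql.
  rewrite /C in lo; lra.
rewrite E8.
have t1 : (C * D ^+ 2 - q * h ^+ 2) ^+ 2 <= (D ^+ 2 * (1 - h + k * h ^+ 2)) ^+ 2.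
  rewrite -(@real_normK _ (C * D ^+ 2 - q * h ^+ 2)) ?num_real//.
  have qh : `|q * h ^+ 2| <= h ^+ 2.
    by rewrite normrM (ger0_norm h2) ler_piMl// ler_norml.
  have m0 : 0 <= D ^+ 2 * (1 - h + k * h ^+ 2).
    by apply: mulr_ge0 => //; have := mulr_ge0 (ltW k0) h2; lra.
  rewrite ler_pXn2r// ?nnegrE//.
  rewrite (le_trans (ler_normB _ _))//.
  rewrite (_ : `|C * D ^+ 2| = C * D ^+ 2); last by rewrite ger0_norm// mulr_ge0// /C; lra.
  by rewrite /C; lra.
(* [S ^+ 2 <= 2 * h] and [|a * b| <= 1 / 2], so this term is at most [h ^+ 2], of second order. *)
have t2 : (S ^+ 2 * a * b) ^+ 2 <= D ^+ 4 * (k ^+ 2 * h ^+ 2).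
  have SE : S ^+ 2 = 1 - C ^+ 2 by apply/eqP; rewrite eq_sym subr_eq addrC CS.
  have S2h : S ^+ 2 <= 2 * h by rewrite SE /C; lra.
  have ab1 : `|a * b| <= 1 / 2.
    rewrite ler_norml; apply/andP; split.
      by have := sqr_ge0 (a + b); have := sqr_ge0 q; lra.
    by have := sqr_ge0 (a - b); have := sqr_ge0 q; lra.
  rewrite -(@real_normK _ (S ^+ 2 * a * b)) ?num_real//.
  rewrite -mulrA normrM (ger0_norm (sqr_ge0 S)).
  rewrite (_ : D ^+ 4 * (k ^+ 2 * h ^+ 2) = (k * D ^+ 2 * h) ^+ 2); last by ring.
  have g1 : 0 <= S ^+ 2 * `|a * b| by apply: mulr_ge0 => //; exact: sqr_ge0.
  have g2 : 0 <= k * D ^+ 2 * h.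
    by apply: mulr_ge0; [apply: mulr_ge0 => //|]; exact: ltW.
  rewrite ler_pXn2r// ?nnegrE//.
  apply: (@le_trans _ _ (2 * h * (1 / 2))).
    by apply: ler_pM => //; exact: sqr_ge0.
  have : h <= k * D ^+ 2 * h by rewrite ler_peMl// ltW.
  lra.
have : (4 * p) ^+ 2 <= (D ^+ 2 * (1 - h + k * h ^+ 2)) ^+ 2 + D ^+ 4 * (k ^+ 2 * h ^+ 2).
  by rewrite pE lerD.
lra.
Qed.

(** To first order the left side is [- t * h] and the right side [- h], so [t > 1] decides for small
    [h]. *)
Lemma small_step (t k : R) : 1 < t -> 0 < k -> exists h : R,
  [/\ 0 < h < 1, 0 < 1 - h - k * h ^+ 2 &
   t / 2 * ln ((1 - h + k * h ^+ 2) ^+ 2 + k ^+ 2 * h ^+ 2) <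
   ln (1 - h - k * h ^+ 2)].
Proof.
move=> t1 k0.
(* Second-order constants: the logarithm on the left is at most [- 2 * h + A * h ^+ 2], the one on
   the right at least [- h - B * h ^+ 2]. [N] makes [h * (B + t * A / 2) < t - 1] and keeps
   [h + k * h ^+ 2] below [1 / 2]. *)
pose A := 2 * k + 1 + 2 * k ^+ 2; pose B := k + 2 * (1 + k) ^+ 2.
have A0 : 0 < A by rewrite /A; have := sqr_ge0 k; lra.
have B0 : 0 < B by rewrite /B; have := sqr_ge0 (1 + k); lra.
pose N := (t - 1) * (2 * (1 + k)) + 2 * (B + t * A / 2).
have tA : 0 < t * A / 2 by rewrite divr_gt0// mulr_gt0//; lra.
have tk : 0 < (t - 1) * (2 * (1 + k)) by rewrite !mulr_gt0//; lra.
have N0 : 0 < N by rewrite /N; lra.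
pose h := (t - 1) / N.
have hN : h * N = t - 1 by rewrite /h divfK// gt_eqF.
have h0 : 0 < h by rewrite divr_gt0// subr_gt0.
have hN' : h * ((t - 1) * (2 * (1 + k))) + h * (2 * (B + t * A / 2)) = t - 1.
  by rewrite -mulrDr.
have hk : h * (2 * (1 + k)) <= 1.
  rewrite -(@ler_pM2l _ (t - 1)) ?subr_gt0// mulr1.
  have : 0 <= h * (2 * (B + t * A / 2)).
    by rewrite mulr_ge0 ?(ltW h0)// mulr_ge0// addr_ge0// ltW.
  by move=> ?; lra.
have hB : h * (B + t * A / 2) < t - 1.
  have : 0 < h * ((t - 1) * (2 * (1 + k))) by rewrite mulr_gt0.
  have : 0 < h * (B + t * A / 2) by rewrite mulr_gt0//; lra.
  by move=> *; lra.
have hk0 : 0 < h * k by rewrite mulr_gt0.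
have h12 : h <= 1 / 2 by lra.
have hh : 0 <= h ^+ 2 by exact: sqr_ge0.
pose z := h + k * h ^+ 2.
have zh : z <= h * (1 + k) by rewrite /z; nra.
have z0 : 0 < z by rewrite /z ltr_pwDl// mulr_ge0// ltW.
have z12 : z <= 1 / 2 by lra.
exists h; split; first by rewrite h0/=; lra.
  by rewrite -addrA -opprD -/z; lra.
have lnz : - (z + 2 * z ^+ 2) <= ln (1 - z).
  rewrite lerNl -lnV ?posrE; last by lra.
  have -> : (1 - z)^-1 = 1 + z / (1 - z) by field; lra.
  rewrite (le_trans (le_ln1Dx _))//.
    by rewrite (lt_le_trans (ltrN10 R))// divr_ge0//; lra.
  by rewrite ler_pdivrMr; [nra|lra].
have zz : z ^+ 2 <= (h * (1 + k)) ^+ 2 by rewrite ler_pXn2r// nnegrE ?ltW// mulr_gt0//; lra.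
have zE : 1 - h - k * h ^+ 2 = 1 - z by rewrite /z opprD addrA.
rewrite zE.
apply: (lt_le_trans _ lnz).
pose W := - (2 * h) + A * h ^+ 2.
have WE : (1 - h + k * h ^+ 2) ^+ 2 + k ^+ 2 * h ^+ 2 <= 1 + W.
  rewrite /W /A.
  have : k ^+ 2 * h ^+ 4 <= k ^+ 2 * h ^+ 2.
    rewrite ler_wpM2l ?sqr_ge0// (_ : h ^+ 4 = h ^+ 2 * h ^+ 2); last by ring.
    by rewrite ler_piMl// expr_le1//; lra.
  have : 0 <= k * h ^+ 3 by rewrite mulr_ge0 ?ltW// exprn_gt0.
  have : h ^+ 2 = h * h by ring.
  nra.
have P0 : 0 < (1 - h + k * h ^+ 2) ^+ 2 + k ^+ 2 * h ^+ 2.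
  have b0 : 0 < 1 - h + k * h ^+ 2 by have := mulr_ge0 (ltW k0) hh; lra.
  by apply: ltr_pwDl; [exact: exprn_gt0|rewrite mulr_ge0// sqr_ge0].
have lnW : ln ((1 - h + k * h ^+ 2) ^+ 2 + k ^+ 2 * h ^+ 2) <= W.
  rewrite (le_trans _ (le_ln1Dx (x := W) _))//; last by lra.
  by rewrite ler_ln// posrE; lra.
apply: (@le_lt_trans _ _ (t / 2 * W)).
  by rewrite ler_pM2l//; lra.
rewrite /W.
have : h * (h * (B + t * A / 2)) < h * (t - 1) by rewrite ltr_pM2l.
have : h * h = h ^+ 2 by ring.
rewrite /B; rewrite /z in zz *; nra.
Qed.

End FourPoints.

(** * Principle of domination *)

Section Pk.
Variable R : realType.
Implicit Types x y : pt3 R.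

Lemma pk_ge0 k (xs : 'I_k -> pt3 R) x : 0 <= pk xs x.
Proof. by apply: prodr_ge0 => j _; exact: edist_ge0. Qed.

Lemma prod_unit_lipschitz k (a b : 'I_k -> R) (d : R) :
  (forall j, 0 <= a j <= 1) -> (forall j, 0 <= b j <= 1) ->
  (forall j, a j <= b j + d) -> 0 <= d ->
  \prod_(j < k) a j <= \prod_(j < k) b j + k%:R * d.
Proof.
move=> + + + d0; elim: k a b => [|k IH] a b ha hb hab.
  by rewrite !big_ord0 mul0r addr0.
rewrite !big_ord_recl /=.
have AB := IH (fun j => a (lift ord0 j)) (fun j => b (lift ord0 j)) (fun j => ha _)
   (fun j => hb _) (fun j => hab _).
have A0 : 0 <= \prod_(i < k) a (lift ord0 i).
  by apply: prodr_ge0 => j _; case/andP: (ha (lift ord0 j)).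
have A1 : \prod_(i < k) a (lift ord0 i) <= 1 by apply: prodr_ile1 => j _; exact: ha.
set A := \prod_(i < k) a (lift ord0 i) in AB A0 A1 *.
set B := \prod_(i < k) b (lift ord0 i) in AB *.
move: (ha ord0) (hb ord0) (hab ord0) => /andP[a00 a01] /andP[b00 b01].
move: (a ord0) (b ord0) a00 a01 b00 b01 => a0 b0 a00 a01 b00 b01 ab.
rewrite -natr1 mulrDl mul1r.
apply: (@le_trans _ _ ((b0 + d) * A)); first by rewrite ler_wpM2r.
rewrite mulrDl; apply: (@le_trans _ _ (b0 * A + d)).
  by rewrite lerD2l ler_piMr.
rewrite addrA lerD2r; apply: (@le_trans _ _ (b0 * (B + k%:R * d))).
  by rewrite ler_wpM2l.
by rewrite mulrDr lerD2l ler_piMl// mulr_ge0.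
Qed.

Lemma pk_lipschitz k (xs : 'I_k -> pt3 R) x y :
  (forall j, sphereS (xs j)) -> sphereS x -> sphereS y ->
  pk xs x <= pk xs y + k%:R * edist x y.
Proof.
move=> Sxs Sx Sy; apply: prod_unit_lipschitz; last exact: edist_ge0.
- by move=> j; rewrite edist_ge0 edist_sphere_le1.
- by move=> j; rewrite edist_ge0 edist_sphere_le1.
- by move=> j; rewrite addrC edist_triangle.
Qed.

(** Factors are at most 1 on the sphere. Thus a positive value of [pk] bounds the distance to every
    zero from below. *)
Lemma pk_le_edist k (xs : 'I_k -> pt3 R) x j :
  (forall j, sphereS (xs j)) -> sphereS x -> pk xs x <= edist x (xs j).
Proof.
move=> Sxs Sx; rewrite /pk (bigD1 j)//= ler_piMr ?edist_ge0//.
by apply: prodr_ile1 => i _; rewrite edist_ge0 edist_sphere_le1.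
Qed.

Lemma continuous_pk k (xs : 'I_k -> pt3 R) : continuous (pk xs).
Proof.
elim: k xs => [|k IH] xs x.
  by rewrite (_ : pk xs = cst 1); [exact: cvg_cst|apply/funext => y; exact: big_ord0].
rewrite (_ : pk xs = (fun y => edist y (xs ord0) * pk (fun j => xs (lift ord0 j)) y)).
  by apply: cvgM; [exact: continuous_edist|exact: IH].
by apply/funext => y; exact: big_ord_recl.
Qed.

End Pk.

Section Domination.
Variables (R : realType) (mu : probability (pt3 R) R) (B : R).
Implicit Types x y z : pt3 R.
Local Notation pot := (potential (@logk R)).
Local Notation Z := (supp mu).
Hypothesis muS : prob_on (@sphereS R) mu.
Hypothesis potB : forall y, Z y -> (pot mu y <= B%:E)%E.

Let ZS : Z `<=` @sphereS R.
Proof. exact: supp_sub (@closed_sphereS R) muS. Qed.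

Let cZ : compact Z.
Proof.
apply: (@subclosed_compact _ _ (@sphereS R : set (R * R * R))).
- exact: closed_supp.
- exact: compact_sphereS.
- exact: ZS.
Qed.

Let mZ : measurable Z.
Proof. by apply: closed_measurable3; exact: closed_supp. Qed.

Let Z0 : Z !=set0.
Proof.
apply/set0P/eqP => Ze; have := supp_null mu; rewrite Ze setC0 probability_setT.
by move=> /eqP; rewrite onee_eq0.
Qed.

Let nearest x : exists y, Z y /\ forall z, Z z -> edist x y <= edist x z.
Proof.
have cf : {within Z, continuous (fun y => edist y x)}.
  by apply: continuous_subspaceT => y; exact: continuous_edist.
have [y] := compact_EVT_min Z0 cZ cf; rewrite inE => Zy ymin; exists y; split => // z Zz.
by rewrite !(edistC x); apply: ymin; rewrite inE.
Qed.

Let nearest_le2 x y z : (forall z, Z z -> edist x y <= edist x z) -> Z z ->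
  edist y z <= 2 * edist x z.
Proof.
move=> ymin Zz; rewrite (le_trans (edist_triangle x _ _))// (edistC y).
by have := ymin z Zz; lra.
Qed.

Lemma pot_bounded x : (pot mu x <= (B + ln 2)%:E)%E.
Proof.
have [y [Zy ymin]] := nearest x.
rewrite EFinD (le_trans (pot_comparison_cst (x' := y) mZ (supp_null mu) (_ : 1 <= 2) _))//.
- by rewrite ler1n.
- by move=> z Zz; exact: nearest_le2.
- by apply: leeD => //; exact: potB.
Qed.

Definition upot x : R := fine (pot mu x).
Local Notation u := upot.

Lemma upotE x : pot mu x = (u x)%:E.
Proof.
rewrite fineK// ge0_fin_numE ?pot_ge0//.
by rewrite (le_lt_trans (pot_bounded x))// ltry.
Qed.

Opaque upot.

Let uB y : Z y -> u y <= B.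
Proof. by move=> Zy; rewrite -lee_fin -upotE potB. Qed.

Lemma upot_near_supp (e : R) : 0 < e -> exists2 d : R, 0 < d &
  forall x y, Z y -> (forall z, Z z -> edist x y <= edist x z) ->
    edist x y < d -> u x <= u y + e.
Proof.
move=> e0; have l2 : 0 < ln 2 :> R by rewrite ln_gt0// ltr1n.
have B1 : 0 < `|B| + 1 by rewrite ltr_wpDl.
(* By [pot_ball] the ball of radius [r = expR (- T)] about [y] has mass at most [B / T], so [ln 2]
   times this mass is at most [e / 2]. The two bounds in [d] serve outside the ball:
   [|x - z| >= r / 2] there, and [2 * |x - y| / r <= e / 2]. *)
pose T := 2 * ln 2 / e * (`|B| + 1).
pose r := expR (- T); have r0 : 0 < r := expR_gt0 _.
pose d := Num.min (r / 2) (r * e / 4).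
have d0 : 0 < d by rewrite lt_min !divr_gt0// mulr_gt0.
exists d => // x y Zy ymin xyd.
have [xr xre] : edist x y < r / 2 /\ edist x y < r * e / 4.
  by move: xyd; rewrite lt_min => /andP[].
pose A := [set z | edist z y < r]; have mA : measurable A := measurable_edist_ball y r.
(* The allowed kernel error: [e / 2] everywhere, plus inside the small ball the [ln 2] coming from
   [nearest_le2]. *)
pose h z : \bar R := ((e / 2)%:E + (ln 2)%:E * (\1_A z)%:E)%E.
have mh1 : measurable_fun setT (fun z => (ln 2)%:E * (\1_A z)%:E : \bar R)%E.
  by apply: measurable_funeM; apply/measurable_EFinP; exact: measurable_indic.
have i0 z : (0 <= (ln 2)%:E * (\1_A z)%:E :> \bar R)%E by rewrite mule_ge0 ?lee_fin// ltW.
have : (pot mu x <= pot mu y + \int[mu]_z h z)%E.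
  apply: (pot_comparison (h := h) mZ (supp_null mu)).
  - by apply: emeasurable_funD.
  - by move=> z; rewrite adde_ge0// lee_fin divr_ge0// ltW.
  - move=> z Zz; rewrite /h indicE; case: (boolP (z \in A)) => [_|]/=.
      rewrite mule1 (le_trans (logk_comparison (c := 2) _ (nearest_le2 ymin Zz)))//.
        by rewrite ler1n.
      by rewrite leeD// -EFinD lee_fin lerDr divr_ge0// ltW.
    rewrite notin_setE => /negP; rewrite -leNgt => rz; rewrite mule0 adde0.
    have xz : r / 2 <= edist x z.
      by have := edist_triangle x z y; rewrite (edistC z x); lra.
    have c1 : 1 <= 1 + 2 * edist x y / r.
      by rewrite lerDl divr_ge0 ?mulr_ge0 ?edist_ge0// ltW.
    have le : edist y z <= (1 + 2 * edist x y / r) * edist x z.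
      rewrite (le_trans (edist_triangle x _ _))// (edistC y x) mulrDl mul1r addrC lerD2l.
      have q0 : 0 <= edist x y / r by rewrite divr_ge0 ?edist_ge0// ltW.
      have qr : edist x y / r * r = edist x y by rewrite divfK// gt_eqF.
      by have := ler_wpM2l q0 xz; rewrite -mulrA; lra.
    rewrite (le_trans (logk_comparison c1 le))// leeD// lee_fin.
    rewrite (le_trans (le_ln1Dx _))//; first by lra.
    by rewrite ler_pdivrMr//; lra.
have iA : (\int[mu]_z h z = (e / 2)%:E + (ln 2)%:E * mu A)%E.
  rewrite /h ge0_integralD//; last by move=> z _; rewrite lee_fin divr_ge0// ltW.
  rewrite integral_cst_probability ge0_integralZl//; last 2 first.
  - by apply/measurable_EFinP; exact: measurable_indic.
  - by rewrite lee_fin ltW.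
  by rewrite integral_indic// setIT.
have pb := pot_ball mu y r0.
have muA : mu A = (fine (mu A))%:E by rewrite fineK// fin_num_measure.
move: pb; rewrite -/A /r expRK opprK upotE muA -EFinM lee_fin => Tm.
rewrite iA ?upotE muA -EFinM -!EFinD lee_fin => /le_trans; apply.
rewrite lerD2l.
suff : ln 2 * fine (mu A) <= e / 2 by lra.
have m0 : 0 <= fine (mu A) by rewrite fine_ge0.
have TB : T * fine (mu A) <= `|B| + 1.
  by rewrite (le_trans Tm)// (le_trans (uB Zy))// (le_trans (ler_norm _))// lerDl.
have : 2 * ln 2 / e * fine (mu A) <= 1.
  by rewrite -(ler_pM2r B1) mul1r mulrAC.
by rewrite mulrAC ler_pdivrMr//; lra.
Qed.

(** On the support, [|x' - z| <= (1 + |x - x'| / d) * |x - z|]. Only [x] has to be far from the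
    support; used in both directions, the estimate yields continuity of the potential off the
    support. *)
Lemma upot_lipschitz x x' (d : R) : 0 < d -> (forall z, Z z -> d <= edist x z) ->
  u x <= u x' + edist x x' / d.
Proof.
move=> d0 xd; have q0 : 0 <= edist x x' / d by rewrite divr_ge0 ?edist_ge0// ltW.
have le z : Z z -> edist x' z <= (1 + edist x x' / d) * edist x z.
  move=> Zz; rewrite (le_trans (edist_triangle x _ _))// (edistC x' x) mulrDl mul1r addrC lerD2l.
  have qr : edist x x' / d * d = edist x x' by rewrite divfK// gt_eqF.
  by have := ler_wpM2l q0 (xd _ Zz); rewrite qr.
have := pot_comparison_cst mZ (supp_null mu) (_ : 1 <= 1 + edist x x' / d) le.
rewrite lerDl => /(_ q0); rewrite !upotE -EFinD lee_fin => /le_trans; apply.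
by rewrite lerD2l le_ln1Dx// (lt_le_trans (ltrN10 R)).
Qed.

(** Minus half the logarithm of the product hypothesis is a pointwise inequality between kernels,
    integrated against [mu]; a vertex lying at [z] makes the larger side [+oo]. [E <= 1] keeps the
    constant nonnegative, as the integrals of nonnegative functions require. *)
Lemma upot_square x0 x1 x2 x3 x4 (E : R) : 0 < E -> E <= 1 ->
  (forall z, Z z -> 0 < edist x0 z) -> sphereS x0 ->
  [/\ sphereS x1, sphereS x2, sphereS x3 & sphereS x4] ->
  (forall z, Z z -> (edist x1 z * edist x2 z * (edist x3 z * edist x4 z)) ^+ 2 <=
     edist x0 z ^+ 8 * E) ->
  4 * u x0 - ln E / 2 <= u x1 + u x2 + (u x3 + u x4).
Proof.
move=> E0 E1 x0z S0 [S1 S2 S3 S4] H.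
have lE : 0 <= - ln E / 2 by rewrite divr_ge0// oppr_ge0 ln_le0.
have ml (x : pt3 R) : measurable_fun setT (fun z => logk (x, z)) by exact: measurable_logkr.
have l0 x z : (0 <= logk (x, z))%E by exact: logk_ge0.
have pE x : (\int[mu]_z logk (x, z) = (u x)%:E)%E := upotE x.
have i4 : (\int[mu]_z (4%:E * logk (x0, z) + (- ln E / 2)%:E) =
    (4 * u x0 - ln E / 2)%:E)%E.
  rewrite ge0_integralD//; last 2 first.
  - by move=> z _; rewrite mule_ge0// lee_fin.
  - exact: measurable_funeM.
  by rewrite integral_cst_probability ge0_integralZl// pE mulNr.
have i5 : (\int[mu]_z (logk (x1, z) + logk (x2, z) + (logk (x3, z) + logk (x4, z))) =
    (u x1 + u x2 + (u x3 + u x4))%:E)%E.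
  rewrite ge0_integralD//; last 4 first.
  - by move=> z _; rewrite adde_ge0.
  - exact: emeasurable_funD.
  - by move=> z _; rewrite adde_ge0.
  - exact: emeasurable_funD.
  rewrite (ge0_integralD mu measurableT (fun z _ => l0 x1 z) (ml x1) (fun z _ => l0 x2 z) (ml x2)).
  rewrite (ge0_integralD mu measurableT (fun z _ => l0 x3 z) (ml x3) (fun z _ => l0 x4 z) (ml x4)).
  by rewrite !pE.
rewrite -lee_fin -i4 -i5; apply: ae_ge0_le_integral => //.
- by move=> z _; rewrite adde_ge0// mule_ge0// lee_fin.
- by apply: emeasurable_funD => //; exact: measurable_funeM.
- by move=> z _; rewrite !adde_ge0.
- by apply: emeasurable_funD; exact: emeasurable_funD.
exists (~` Z); split; [exact: measurableC|exact: supp_null|].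
apply: subsetC => z Zz /= _.
have Sz := ZS Zz.
have nny x : (logk (x, z) != -oo)%E by rewrite gt_eqF// (lt_le_trans _ (l0 x z))// ltNyr.
have nny2 x y : (logk (x, z) + logk (y, z) != -oo)%E.
  by rewrite gt_eqF// (@lt_le_trans _ _ 0%E) ?ltNyr// adde_ge0.
have inf x : edist x z = 0 -> logk (x, z) = +oo%E by move=> e; rewrite logkE e eqxx.
case: (eqVneq (edist x1 z) 0) => e1; first by rewrite (inf x1 e1) addye// addye// leey.
case: (eqVneq (edist x2 z) 0) => e2; first by rewrite (inf x2 e2) addey// addye// leey.
case: (eqVneq (edist x3 z) 0) => e3; first by rewrite (inf x3 e3) addye// addey// leey.
case: (eqVneq (edist x4 z) 0) => e4; first by rewrite (inf x4 e4) addey// addey// leey.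
rewrite !logk_sphere// !lkerE (gt_eqF (x0z z Zz)) (negbTE e1) (negbTE e2) (negbTE e3) (negbTE e4).
have p1 : 0 < edist x1 z by rewrite lt0r e1 edist_ge0.
have p2 : 0 < edist x2 z by rewrite lt0r e2 edist_ge0.
have p3 : 0 < edist x3 z by rewrite lt0r e3 edist_ge0.
have p4 : 0 < edist x4 z by rewrite lt0r e4 edist_ge0.
have p0 := x0z z Zz.
rewrite -EFinM -!EFinD lee_fin.
have := H z Zz; rewrite -ler_ln ?posrE ?exprn_gt0 ?mulr_gt0 ?exprn_gt0//.
rewrite lnM ?posrE ?exprn_gt0// !lnXn ?mulr_gt0// !lnM ?posrE ?mulr_gt0//.
by rewrite -[_ *+ 2]mulr_natl -[_ *+ 8]mulr_natl; lra.
Qed.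

Variables (k : nat) (xs : 'I_k.+1 -> pt3 R) (t : R).
Hypothesis Sxs : forall j, sphereS (xs j).
Hypothesis t1 : 1 < t.
Variable K : R.
Hypothesis KE : K = k.+1%:R.
Let K0 : 0 < K. Proof. by rewrite KE ltr0n. Qed.
Let H x := pk xs x * expR (K * t * u x).

Let H_ge0 x : 0 <= H x.
Proof. by rewrite mulr_ge0 ?pk_ge0 ?expR_ge0. Qed.

(* The four-point average of log H around a maximum off the support would be
   strictly larger than its value at the centre, since [K * t * mu] has mass [K * t > K]. *)
Lemma no_max_off_supp x0 (d : R) : sphereS x0 -> 0 < d ->
  (forall z, Z z -> d <= edist x0 z) -> 0 < H x0 ->
  ~ (forall x, sphereS x -> H x <= H x0).
Proof.
move=> S0 d0 dz Hp max.
have p0 : 0 < pk xs x0 by move: Hp; rewrite /H pmulr_lgt0// expR_gt0.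
(* [m] bounds from below the distance of [x0] to the support and, by [pk_le_edist], to each zero;
   [c] is chosen so that [4 * c * m ^+ 4 = 1], as [square_product_bounds] asks. *)
pose m := Num.min d (pk xs x0); have m0 : 0 < m by rewrite lt_min d0.
pose c := (4 * m ^+ 4)^-1; have c0 : 0 < c by rewrite invr_gt0 mulr_gt0// exprn_gt0.
have cm y : m <= edist x0 y -> 1 <= 4 * c * edist x0 y ^+ 4.
  move=> my; have mm : m ^+ 4 <= edist x0 y ^+ 4.
    by rewrite ler_pXn2r// nnegrE ?edist_ge0// ltW.
  have e1 : 4 * c * m ^+ 4 = 1 by rewrite /c; field; rewrite gt_eqF.
  by rewrite -[leLHS]e1 ler_pM2l// mulr_gt0.
have [h [h01 g0 lnE]] := small_step t1 c0.
have [x1 [x2 [x3 [x4 [S1234 P]]]]] := square_product_bounds S0 h01.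
set g := 1 - h - c * h ^+ 2 in g0 lnE.
set E := (1 - h + c * h ^+ 2) ^+ 2 + c ^+ 2 * h ^+ 2 in lnE.
have E0 : 0 < E.
  case/andP: h01 => h0 h1; apply: ltr_pwDl; last by rewrite mulr_ge0// sqr_ge0.
  by rewrite exprn_gt0//; have := mulr_ge0 (ltW c0) (sqr_ge0 h); lra.
have lng : ln g <= 0.
  by rewrite ln_le0// /g; case/andP: h01 => h0 h1; have := mulr_ge0 (ltW c0) (sqr_ge0 h); lra.
have lE0 : ln E < 0.
  by have := lt_le_trans lnE lng; rewrite pmulr_rlt0// divr_gt0// (lt_trans ltr01).
have E1 : E <= 1 by rewrite leNgt; apply/negP => /ln_gt0; lra.
have uu : 4 * u x0 - ln E / 2 <= u x1 + u x2 + (u x3 + u x4).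
  apply: upot_square => //.
  - by move=> z Zz; exact: lt_le_trans (dz z Zz).
  - move=> z Zz; have [] := P z c (ZS Zz) c0 => //.
    by apply: cm; rewrite (le_trans _ (dz z Zz))// ge_min lexx.
(* The lower product bound is used at each zero of [pk]; the upper one was used above at the points
   of the support. *)
have pp : pk xs x0 ^+ 4 * g ^+ k.+1 <=
    pk xs x1 * pk xs x2 * (pk xs x3 * pk xs x4).
  have -> : g ^+ k.+1 = \prod_(j < k.+1) g by rewrite prodr_const card_ord.
  rewrite /pk -prodrXl -!big_split/=; apply: ler_prod => j _.
  rewrite mulr_ge0 ?exprn_ge0 ?edist_ge0 ?(ltW g0)//=.
  have [] // := P (xs j) c (Sxs j) c0.
  by apply: cm; rewrite ge_min (pk_le_edist _ Sxs S0) orbT.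
have [S1 S2 S3 S4] := S1234.
have HH : H x1 * H x2 * (H x3 * H x4) <= H x0 ^+ 4.
  rewrite (_ : H x0 ^+ 4 = H x0 * H x0 * (H x0 * H x0)); last by ring.
  by apply: ler_pM; [exact: mulr_ge0 (H_ge0 _) (H_ge0 _)|exact: mulr_ge0 (H_ge0 _) (H_ge0 _)|
    |]; (apply: ler_pM; [exact: H_ge0|exact: H_ge0| |]); exact: max.
have HE : H x1 * H x2 * (H x3 * H x4) =
    pk xs x1 * pk xs x2 * (pk xs x3 * pk xs x4) *
    expR (K * t * (u x1 + u x2 + (u x3 + u x4))).
  have alg (p1 p2 p3 p4 c' u1 u2 u3 u4 : R) :
      p1 * expR (c' * u1) * (p2 * expR (c' * u2)) *
      (p3 * expR (c' * u3) * (p4 * expR (c' * u4))) =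
      p1 * p2 * (p3 * p4) * expR (c' * (u1 + u2 + (u3 + u4))).
    by rewrite !mulrDr !expRD; ring.
  exact: alg.
(* The loss [K * ln g] from the zeros is smaller than the gain [- K * t * ln E / 2] from the
   potential, by the choice of [h] in [small_step]. *)
have : H x0 ^+ 4 < H x1 * H x2 * (H x3 * H x4).
  rewrite HE; apply: (@lt_le_trans _ _ (pk xs x0 ^+ 4 * g ^+ k.+1 *
     expR (K * t * (4 * u x0 - ln E / 2)))); last first.
    apply: ler_pM => //; first by rewrite mulr_ge0// exprn_ge0 ?pk_ge0 ?ltW.
    rewrite ler_expR; apply: ler_wpM2l => //.
    exact: ltW (mulr_gt0 K0 (lt_trans ltr01 t1)).
  have -> : g ^+ k.+1 = expR (K * ln g).
    by rewrite -[g in LHS]lnK ?posrE// -expRM_natl KE.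
  rewrite -mulrA -expRD.
  have -> : H x0 ^+ 4 = pk xs x0 ^+ 4 * expR (K * t * (4 * u x0)).
    by rewrite /H exprMn -expRM_natl; congr (_ * expR _); rewrite mulrCA.
  rewrite ltr_pM2l ?exprn_gt0// ltr_expR.
  by rewrite mulrBr addrCA ltrDl subr_gt0 -mulrA ltr_pM2l// mulrA mulrAC.
by move=> /lt_le_trans/(_ HH); rewrite ltxx.
Qed.

(** This confines the search for a maximum of [H] to a compact set where the potential is
    continuous. *)
Lemma superlevel_far_from_supp (M s : R) : 0 <= M -> M < s -> (forall y, Z y -> H y <= M) ->
  exists2 d, 0 < d & forall x, sphereS x -> s <= H x ->
    forall z, Z z -> d <= edist x z.
Proof.
move=> M0 Ms HM; have t0 : 0 < t := lt_trans ltr01 t1.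
have Kt : 0 < K * t by rewrite mulr_gt0.
have s0 : 0 < s := le_lt_trans M0 Ms.
(* The gap from [M] to [s] is shared: passing from [pk] at [y] to [pk] at [x] may add [(s - M) / 2],
   reaching [c], and the change of potential may then multiply by the square root of [s / c]. *)
pose c := M + (s - M) / 2; have c0 : 0 < c by rewrite /c; lra.
have cs : c < s by rewrite /c; lra.
have ls : 0 < ln (s / c) by rewrite ln_gt0// ltr_pdivlMr// mul1r.
have ee : 0 < ln (s / c) / (2 * (K * t)) by rewrite divr_gt0// mulr_gt0.
have [d1 d10 D1] := upot_near_supp ee.
pose eB := expR (K * t * B); have eB0 : 0 < eB := expR_gt0 _.
pose d2 := (s - M) / 2 / (K * eB).
have d20 : 0 < d2 by rewrite !divr_gt0 ?mulr_gt0// subr_gt0.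
exists (Num.min d1 d2); first by rewrite lt_min d10.
move=> x Sx sH z Zz; rewrite leNgt; apply/negP => xz.
have [y [Zy ymin]] := nearest x.
have := le_lt_trans (ymin z Zz) xz; rewrite lt_min => /andP[xd1 xd2].
have ux := D1 x y Zy ymin xd1.
have px := pk_lipschitz Sxs Sx (ZS Zy).
have : H x < s; last by rewrite ltNge sH.
apply: (@le_lt_trans _ _ (c * expR (ln (s / c) / 2))); last first.
  rewrite -ltr_pdivlMl// (mulrC c^-1) -[ltRHS]lnK ?posrE ?divr_gt0//.
  by rewrite ltr_expR ltr_pdivrMr// ltr_pMr// ltr1n.
apply: (@le_trans _ _ ((pk xs y + K * edist x y) * expR (K * t * u y) * expR (ln (s / c) / 2))).
  rewrite -mulrA -expRD; apply: ler_pM; rewrite ?pk_ge0 ?expR_ge0//; first by rewrite KE.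
  rewrite ler_expR.
  have -> : ln (s / c) / 2 = K * t * (ln (s / c) / (2 * (K * t))).
    by field; rewrite !gt_eqF.
  by rewrite -mulrDr ler_pM2l.
rewrite ler_pM2r ?expR_gt0// mulrDl /c lerD//; first exact: HM.
apply: (@le_trans _ _ (K * edist x y * eB)).
  rewrite ler_wpM2l//; first by rewrite mulr_ge0 ?edist_ge0// ltW.
  by rewrite ler_expR ler_pM2l// uB.
have -> : (s - M) / 2 = K * d2 * eB by rewrite /d2; field; rewrite !gt_eqF.
by rewrite ler_pM2r// ler_pM2l// ltW.
Qed.

Lemma max_principle (M : R) : 0 <= M -> (forall y, Z y -> H y <= M) ->
  forall x, sphereS x -> H x <= M.
Proof.
move=> M0 HM x Sx; rewrite leNgt; apply/negP => Mx.
have [d d0 far] := superlevel_far_from_supp M0 Mx HM.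
(* [D] contains every point of the sphere where [H] is at least [H x], so a maximum over [D] is a
   maximum over the whole sphere. *)
pose D := [set y | sphereS y /\ forall z, Z z -> d <= edist y z].
have Dx : D x by split => //; exact: far.
have cD : compact D.
  apply: (@subclosed_compact _ _ (@sphereS R : set (R * R * R))).
  - rewrite (_ : D = @sphereS R `&` \bigcap_(z in Z) [set y | d <= edist y z]); last first.
      by apply/seteqP; split => y /=; [case=> Sy h; split|case=> Sy h; split].
    apply: closedI; first exact: closed_sphereS.
    apply: closed_bigI => z Zz.
    apply: (@preimage_closed _ _ (fun y : R * R * R => edist y z) [set r : R | d <= r]).
      by move=> y _; exact: continuous_edist.
    exact: closed_ge.
  - exact: compact_sphereS.
  - by move=> y [].
have cu : forall y, D y -> u @ within D (nbhs (y : R * R * R)) --> u y.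
  move=> y [Sy Dy]; apply/cvgrPdist_le => e e0.
  have ed : 0 < e * d by rewrite mulr_gt0.
  have := near_edist y ed; rewrite /within/= /prop_near1/=; apply: filterS => w wy [Sw Dw].
  have l1 := upot_lipschitz w d0 Dy; have l2 := upot_lipschitz y d0 Dw.
  have : edist w y / d <= e by rewrite ler_pdivrMr// ltW.
  rewrite (edistC y w) in l1; move: (u y) (u w) (edist w y / d) l1 l2 => a b q l1 l2 qe.
  by rewrite ler_norml; lra.
have cH : {within D, continuous H}.
  apply/subspace_continuousP => y Dy; apply: cvgM.
    by apply: cvg_within_filter; exact: continuous_pk.
  apply: (@cvg_comp _ _ _ (fun w => K * t * u w) expR _ (nbhs (K * t * u y))).
    by apply: cvgMr => //; exact: cu.
  exact: continuous_expR.
have [x0] := compact_EVT_max (ex_intro _ x Dx) cD cH; rewrite inE => -[S0 D0] max.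
have Hx : H x <= H x0 by apply: max; rewrite inE.
apply: (no_max_off_supp S0 d0 D0).
  by apply: (lt_le_trans _ Hx); exact: le_lt_trans Mx.
move=> y Sy; have [h|h] : H x <= H y \/ H y <= H x by apply/orP; exact: le_total.
  by apply: max; rewrite inE; split => //; exact: far.
exact: le_trans h Hx.
Qed.

End Domination.

Lemma domination (R : realType) (mu : probability (pt3 R) R) (B : R)
    (k : nat) (xs : 'I_k -> pt3 R) (M : R) :
  prob_on (@sphereS R) mu ->
  (forall y, supp mu y -> (potential (@logk R) mu y <= B%:E)%E) ->
  (forall j, sphereS (xs j)) ->
  (forall y, supp mu y -> pk xs y * expR (k%:R * upot mu y) <= M) ->
  forall x, sphereS x -> pk xs x * expR (k%:R * upot mu x) <= M.
Proof.
move=> muS potB Sxs HM x Sx.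
have [y Zy] : supp mu !=set0.
  apply/set0P/eqP => Ze; have := supp_null mu; rewrite Ze setC0 probability_setT.
  by move=> /eqP; rewrite onee_eq0.
have M0 : 0 <= M.
  by rewrite (le_trans _ (HM y Zy))// mulr_ge0 ?pk_ge0 ?expR_ge0.
have u0 w : 0 <= upot mu w by rewrite -lee_fin -(upotE muS potB) pot_ge0.
have uB w : supp mu w -> upot mu w <= B.
  by move=> Zw; rewrite -lee_fin -(upotE muS potB) potB.
have B0 : 0 <= B by exact: le_trans (u0 y) (uB y Zy).
case: k xs Sxs HM => [|k] xs Sxs HM.
  by have := HM y Zy; rewrite !mul0r expR0 /pk !big_ord0.
pose K : R := k.+1%:R; have K0 : 0 < K by rewrite ltr0n.
(* The extra factor [expR (K * (t - 1) * u)] is at most [expR (K * (t - 1) * B)] on the support and,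
   since [u >= 0], at least 1 at [x]. *)
have step t : 1 < t -> pk xs x * expR (K * upot mu x) <= M * expR (K * (t - 1) * B).
  move=> t1.
  have tH : pk xs x * expR (K * t * upot mu x) <= M * expR (K * (t - 1) * B).
    apply: (@max_principle _ mu B muS potB k xs t Sxs t1 K erefl) => //.
      by rewrite mulr_ge0 ?expR_ge0.
    move=> w Zw.
    rewrite (_ : K * t * upot mu w = K * upot mu w + K * (t - 1) * upot mu w); last by ring.
    rewrite expRD mulrA; apply: ler_pM; rewrite ?mulr_ge0 ?pk_ge0 ?expR_ge0//.
      exact: HM.
    by rewrite ler_expR ler_wpM2l ?uB// mulr_ge0 ?ltW// subr_gt0.
  rewrite (le_trans _ tH)// ler_wpM2l ?pk_ge0// ler_expR -mulrA ler_pM2l//.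
  by rewrite ler_peMl// ltW.
rewrite leNgt; apply/negP => lt.
have [M00|Mn0] := eqVneq M 0.
  by have := step 2 (_ : 1 < 2); rewrite ltr1n M00 mul0r => /(_ isT); rewrite leNgt -M00 lt.
have Mp : 0 < M by rewrite lt0r Mn0.
pose V := pk xs x * expR (K * upot mu x).
have Vp : 0 < V := lt_trans Mp lt.
have lr : 0 < ln (V / M) by rewrite ln_gt0// ltr_pdivlMr// mul1r.
have KB : 0 < K * B + 1 by rewrite ltr_wpDl// mulr_ge0// ltW.
(* With [t = 1 + e] the allowed excess [K * e * B] stays strictly below [ln (V / M)], contradicting
   [step]. *)
pose e := ln (V / M) / (K * B + 1).
have e0 : 0 < e by rewrite divr_gt0.
have := step (1 + e) (_ : 1 < 1 + e); rewrite ltrDl => /(_ e0).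
rewrite leNgt => /negP; apply.
rewrite -/V -ltr_pdivlMl// (mulrC M^-1) -[ltRHS]lnK ?posrE ?divr_gt0//.
rewrite ltr_expR.
have eE : e * (K * B + 1) = ln (V / M) by rewrite /e divfK// gt_eqF.
rewrite -eE (_ : 1 + e - 1 = e); last by ring.
rewrite mulrDr mulr1 -mulrA mulrCA; lra.
Qed.

(** * Equilibrium conditions *)

Section Lsc.
Variable R : realType.
Implicit Types (x : pt3 R) (f g : pt3 R -> \bar R).

Definition lsc f := forall x (a : R), (a%:E < f x)%E ->
  \forall y \near x, (a%:E < f y)%E.

Lemma lsc_measurable f : lsc f -> measurable_fun setT f.
Proof.
move=> fl; apply: (measurability _ (ErealGenOInfty.measurableE R)).
move=> /= _ [_ [a ->]] <-; apply: measurableI => //; apply: open_measurable3.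
by rewrite preimage_itvoy openE => x /= ax; exact: fl.
Qed.

Lemma lscD f g : (forall x, 0 <= f x)%E -> (forall x, 0 <= g x)%E ->
  lsc f -> lsc g -> lsc (fun x => f x + g x)%E.
Proof.
move=> f0 g0 fl gl x a.
case fx : (f x) => [r| |]; last by move: (f0 x); rewrite fx.
- case gx : (g x) => [s| |]; last by move: (g0 x); rewrite gx.
  + rewrite -EFinD lte_fin => ars; pose d := (r + s - a) / 2.
    have d0 : 0 < d by rewrite divr_gt0// subr_gt0.
    have fd : ((r - d)%:E < f x)%E by rewrite fx lte_fin ltrBlDr ltrDl.
    have gd : ((s - d)%:E < g x)%E by rewrite gx lte_fin ltrBlDr ltrDl.
    apply: filterS2 (fl x _ fd) (gl x _ gd) => y h1 h2.
    rewrite (_ : a%:E = (r - d)%:E + (s - d)%:E)%E; first exact: lteD.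
    by rewrite -EFinD; congr EFin; rewrite /d; lra.
  + move=> _; have := gl x a; rewrite gx ltry => /(_ isT).
    by apply: filterS => y /lt_le_trans; apply; rewrite leeDr.
- move=> _; have := fl x a; rewrite fx ltry => /(_ isT).
  by apply: filterS => y /lt_le_trans; apply; rewrite leeDl.
Qed.

End Lsc.

Section Equilibrium.
Variables (R : realType) (K : set (pt3 R)) (Q : pt3 R -> \bar R).
Hypotheses (clK : closed K) (KS : K `<=` @sphereS R).
Hypothesis admQ : admissible K Q.
Implicit Types (x y z : pt3 R) (nu : probability (pt3 R) R).
Local Notation II := (mutual_energy (@logk R)).
Local Notation pot := (potential (@logk R)).

Let mK : measurable K. Proof. exact: closed_measurable3. Qed.

Let cK : compact K.
Proof.
apply: (@subclosed_compact _ _ (@sphereS R : set (R * R * R))) => //.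
exact: compact_sphereS.
Qed.

Lemma prob_on_sphere nu : prob_on K nu -> prob_on (@sphereS R) nu.
Proof.
move=> nuK; apply: (@subset_measure0 _ _ _ _ _ (~` K)) => //; try exact: measurableC.
  by apply: measurableC; apply: closed_measurable3; exact: closed_sphereS.
exact: subsetC.
Qed.

Lemma compact_measurable3 (C : set (pt3 R)) : compact C -> measurable C.
Proof.
move=> cC; apply: closed_measurable3.
by apply: (@compact_closed (R * R * R)%type) => //; exact: norm_hausdorff.
Qed.

(** Every point of [K] has a neighbourhood where [Q > - n] for some [n]; compactness provides a
    common [n]. *)
Lemma weight_bounded_below : exists2 c : R, 0 <= c &
  forall x, K x -> ((- c)%:E <= Q x)%E.
Proof.
have [Ql QN _] := admQ.
have /compact_near_coveringP cov := cK.
have [|n _ /(_ n (leqnn n)) h] :=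
    cov nat (nbhs \oo) (fun n x => K x -> ((- n%:R)%:E < Q x)%E).
- move=> x Kx.
  have [n xn] : exists n : nat, ((- n%:R)%:E < Q x)%E.
    have := QN x Kx; case: (Q x) => [r| |]// _; last by exists 0%N; rewrite ltry.
    exists (Num.truncn `|r|).+1; rewrite lte_fin ltrNl.
    by rewrite (le_lt_trans (ler_norm _))// normrN truncnS_gt.
  have := Ql x Kx _ xn => xnear.
  exists ([set y | K y -> ((- n%:R)%:E < Q y)%E], [set m | (n <= m)%N]).
    by split => //=; exists n.
  move=> [y m] /= [h nm] Ky; apply: le_lt_trans (h Ky).
  by rewrite lee_fin lerN2 ler_nat.
by exists n%:R => // x Kx; apply: ltW; exact: h.
Qed.

Variable c : R.
Hypotheses (c0 : 0 <= c) (Qc : forall x, K x -> ((- c)%:E <= Q x)%E).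

(* The weight made nonnegative by a shift and extended by +oo off K, so that it is
   lower semicontinuous on the whole space. *)
Definition shifted x : \bar R := if `[< K x >] then (Q x + c%:E)%E else +oo%E.
Local Notation q := shifted.

Let qK x : K x -> q x = (Q x + c%:E)%E.
Proof. by move=> Kx; rewrite /q asboolT. Qed.

Lemma shifted_ge0 x : (0 <= q x)%E.
Proof.
rewrite /q; case: asboolP => // Kx; rewrite -leeBlDr// sub0e -EFinN.
exact: Qc.
Qed.

Lemma shifted_lsc : lsc q.
Proof.
have [Ql _ _] := admQ; move=> x a; have [Kx|Kx] := pselect (K x).
  rewrite qK// -lteBlDr// -EFinB => /(Ql x Kx); apply: filterS => y h.
  rewrite /q; case: asboolP => [Ky|_]; last by rewrite ltry.
  by rewrite -lteBlDr// -EFinB; exact: h.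
move=> _; have := open_nbhs_nbhs (conj (closed_openC clK) Kx); apply: filterS => y Ky.
by rewrite /q asboolF// ltry.
Qed.

Let mq : measurable_fun setT q.
Proof. exact: lsc_measurable shifted_lsc. Qed.

Let integral_on nu (f : pt3 R -> \bar R) : prob_on K nu -> measurable_fun setT f ->
  (forall x, 0 <= f x)%E -> (\int[nu]_x f x = \int[nu]_(x in K) f x)%E.
Proof.
move=> nuK mf f0; rewrite (@ge0_negligible_integral _ _ _ _ _ (~` K))//.
  by rewrite setDE setCK setTI.
exact: measurableC.
Qed.

Let mQ : measurable_fun K Q.
Proof.
have : measurable_fun K (fun x => q x - c%:E)%E.
  by apply: emeasurable_funB => //; exact: measurable_funTS.
by apply: eq_measurable_fun => x; rewrite inE => Kx; rewrite qK// addeK.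
Qed.

Let nu_K nu : prob_on K nu -> nu K = 1%E.
Proof.
move=> nuK; have := probability_setC nu mK; rewrite nuK => /esym/eqP.
by rewrite sube_eq ?fin_num_measure ?add0e// => /eqP.
Qed.

Lemma integral_shifted nu : prob_on K nu ->
  (\int[nu]_(x in K) Q x = \int[nu]_x q x - c%:E)%E.
Proof.
move=> nuK; rewrite integralE (integral_on nuK mq shifted_ge0).
have cst : (\int[nu]_(x in K) c%:E = c%:E)%E.
  by have := integral_cst nu mK c%:E; rewrite /= nu_K// mule1.
have negc : (\int[nu]_(x in K) Q^\- x <= c%:E)%E.
  rewrite -[leRHS]cst; apply: ge0_le_integral => //.
  - exact: measurable_funeneg.
  - move=> x Kx; rewrite funenegE ge_max lee_fin c0 andbT leeNl -EFinN.
    exact: Qc.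
(* [q = Q + c] rearranged so that all terms are nonnegative and integrals add; the integral of
   [Q^\-] is at most [c], hence can be subtracted even when that of [Q] is [+oo]. *)
have : (\int[nu]_(x in K) (Q^\+ x + c%:E) = \int[nu]_(x in K) (q x + Q^\- x))%E.
  apply: eq_integral => x; rewrite inE => Kx; rewrite qK// funeposE funenegE.
  have := Qc Kx; case: (Q x) => [r| |]// _; last first.
    by rewrite (@max_l _ _ +oo%E 0%E) ?leey// (@max_r _ _ (- +oo)%E 0%E) ?leNye// adde0.
  rewrite -!EFinN -!EFin_max -!EFinD; congr EFin.
  have /orP[r0|r0] := le_total 0 r.
    by rewrite (max_l r0) max_r ?oppr_le0//; ring.
  by rewrite (max_r r0) max_l ?oppr_ge0//; ring.
rewrite ge0_integralD//; last exact: measurable_funepos.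
rewrite ge0_integralD//; last 3 first.
- by move=> x _; exact: shifted_ge0.
- exact: measurable_funTS.
- exact: measurable_funeneg.
rewrite cst.
have : (0 <= \int[nu]_(x in K) Q^\- x)%E by apply: integral_ge0.
have : (0 <= \int[nu]_(x in K) q x)%E.
  by apply: integral_ge0 => x _; exact: shifted_ge0.
move: negc; case: (\int[nu]_(x in K) Q^\- x)%E => [n| |]// _.
case: (\int[nu]_(x in K) q x)%E => [b| |]// _ _;
  case: (\int[nu]_(x in K) Q^\+ x)%E => [p| |]//=.
by move=> [] h; rewrite -!EFinB; congr EFin; lra.
Qed.

Lemma wenergy_shifted nu : prob_on K nu ->
  (wenergy K Q nu = weighted_energy (@logk R) q nu - (2 * c)%:E)%E.
Proof.
move=> nuK; rewrite /wenergy integral_shifted// (energy_mutual (prob_on_sphere nuK)).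
rewrite /weighted_energy.
have : (0 <= II nu nu)%E by apply: mutual_energy_ge0; exact: logk_ge0.
have : (0 <= \int[nu]_x q x)%E by apply: integral_ge0 => x _; exact: shifted_ge0.
case: (\int[nu]_x q x)%E => [b| |]// _; case: (II nu nu) => [a| |]// _.
- by rewrite -EFinB -!EFinM -!EFinD; congr EFin; ring.
- by rewrite addye// mulry gtr0_sg// mul1e.
- by rewrite addye// mulry gtr0_sg// mul1e.
Qed.

Lemma finite_weighted_energy : exists2 nu, prob_on K nu &
  (weighted_energy (@logk R) q nu < +oo)%E.
Proof.
have [_ _ nlp] := admQ.
(* By definition a set also fails to be [logpolar] when it is not measurable; excluding this leaves
   a compact subset carrying a measure of finite energy. *)
have mE : measurable [set x | K x /\ (Q x < +oo)%E].
  rewrite (_ : mkset _ = K `&` [set x | (Q x < +oo)%E])//.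
  exact: emeasurable_fun_infty_o.
have [C [comC [CE [nu [nuC nuy]]]]] : exists C, compact C /\
    (C `<=` [set x | K x /\ (Q x < +oo)%E] /\
    exists nu, prob_on C nu /\ energy nu <> +oo%E).
  apply: contrapT => h; apply: nlp; split => // C comC CE nu nuC.
  by apply: contrapT => e; apply: h; exists C; do 2 split => //; exists nu.
have mC := compact_measurable3 comC.
have CK : C `<=` K by move=> x /CE[].
have nuK : prob_on K nu.
  apply: (@subset_measure0 _ _ _ _ _ (~` C)) => //; try exact: measurableC.
  exact: subsetC.
(* The weight is finite on [C] but its integral may diverge; conditioning to a set [A n] of positive
   mass bounds it and keeps the energy finite. *)
pose A n := C `&` [set x | (q x <= n%:R%:E)%E].
have mA n : measurable (A n).
  apply: measurableI => //; rewrite -[X in measurable X]setTI.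
  exact: emeasurable_fun_infty_c.
have [n An] : exists n, (0 < nu (A n))%E.
  apply: contrapT => /forallNP h.
  have An0 n : nu (A n) = 0%E.
    by apply/eqP; rewrite eq_le measure_ge0 andbT leNgt; apply/negP.
  have CU : C = \bigcup_n A n.
    apply/seteqP; split=> [x Cx|x [n _] []//].
    have [Kx Qx] := CE x Cx; have := Qc Kx.
    case Qr : (Q x) => [r| |]//; last by move: Qx; rewrite Qr.
    move=> _; exists (Num.truncn `|r + c|).+1 => //; split => //=.
    rewrite qK// Qr -EFinD lee_fin (le_trans (ler_norm _))// ltW//.
    exact: truncnS_gt.
  have : nu C = 0%E.
    apply/(negligibleP nu mC); rewrite CU; apply: negligible_bigcup => n.
    by apply/(negligibleP nu (mA n)); exact: An0.
  have -> : nu C = 1%E.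
    have := probability_setC nu mC; rewrite nuC => /esym/eqP.
    by rewrite sube_eq ?fin_num_measure ?add0e// => /eqP.
  by move=> /eqP; rewrite onee_eq0.
have [tau [tauB tauf]] := conditional_exists (mA n) An.
set a := (fine (nu (A n)))^-1 in tauB tauf.
have a0 : 0 <= a by rewrite invr_ge0 fine_ge0.
exists tau.
  rewrite /prob_on tauB; last exact: measurableC.
  rewrite (_ : ~` K `&` A n = set0) ?measure0 ?mule0//.
  by apply/seteqP; split => // x [nKx [/CK]].
have E1 : (II tau tau < +oo)%E.
  apply: (dominated_energy_lty (@measurable_logk R) (@logk_ge0 R) (c := a) (mu := nu)) => //.
    move=> f mf f0; rewrite tauf//; apply: lee_wpmul2l; first by rewrite lee_fin.
    by apply: ge0_subset_integral.
  rewrite ltey; apply/eqP; rewrite -energy_mutual//.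
  exact: prob_on_sphere.
have E2 : (\int[tau]_x q x < +oo)%E.
  rewrite tauf//; last exact: shifted_ge0.
  apply: (@le_lt_trans _ _ (a%:E * n%:R%:E)%E); last by rewrite -EFinM ltry.
  apply: lee_wpmul2l; first by rewrite lee_fin.
  apply: (@le_trans _ _ (\int[nu]_(x in A n) n%:R%:E)%E).
    apply: ge0_le_integral => //.
    - by move=> x _; exact: shifted_ge0.
    - exact: measurable_funTS.
    - by move=> x [].
  have := integral_cst nu (mA n) n%:R%:E; rewrite /= => ->.
  by rewrite -[leRHS]mule1 lee_wpmul2l// ?lee_fin// probability_le1.
have : (0 <= \int[tau]_x q x)%E by apply: integral_ge0 => x _; exact: shifted_ge0.
rewrite /weighted_energy; move: E1 E2; have := mutual_energy_ge0 (@logk_ge0 R) tau tau.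
case: (II tau tau) => [r| |]//; case: (\int[tau]_x q x)%E => [s| |]// *.
by rewrite -EFinM -EFinD ltry.
Qed.

Variable mu : probability (pt3 R) R.
Hypothesis muQ : is_eq_measure K Q mu.
Let muK : prob_on K mu. Proof. by case: muQ. Qed.
Let muS : prob_on (@sphereS R) mu. Proof. exact: prob_on_sphere. Qed.

Lemma eq_measure_min nu : prob_on K nu ->
  (weighted_energy (@logk R) q mu <= weighted_energy (@logk R) q nu)%E.
Proof.
move=> nuK; have := muQ.2 nu nuK; rewrite !wenergy_shifted//.
by rewrite leeD2rE.
Qed.

Lemma eq_measure_fin : (weighted_energy (@logk R) q mu < +oo)%E.
Proof.
have [nu nuK nufin] := finite_weighted_energy.
exact: le_lt_trans (eq_measure_min nuK) nufin.
Qed.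

(** Frostman's constant for the shifted weight: it is [Fw] plus the shift [c]. *)
Definition eq_const : R := fine (\int[mu]_x (pot mu x + q x))%E.

Lemma eq_constE : (\int[mu]_x (pot mu x + q x) = eq_const%:E)%E.
Proof.
rewrite /eq_const fineK//.
apply: (minimizer_equilibrium_fin (@measurable_logk R) (@logk_ge0 R) mq shifted_ge0).
exact: eq_measure_fin.
Qed.

Lemma FwE : Fw K Q mu = (eq_const - c)%:E.
Proof.
have -> : Fw K Q mu = (wenergy K Q mu - \int[mu]_(x in K) Q x)%E.
  congr (_ - _)%E; apply/eqP; rewrite eq_le; apply/andP; split.
    by apply: ereal_inf_lbound; exists mu.
  by apply: le_ereal_inf_tmp => _ [nu nuK <-]; exact: muQ.2.
rewrite wenergy_shifted// integral_shifted//.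
have := eq_constE; rewrite ge0_integralD//; last 3 first.
- by move=> x _; exact: pot_ge0.
- exact: measurable_pot.
- by move=> x _; exact: shifted_ge0.
have [] := weighted_energy_lty (@logk_ge0 R) shifted_ge0 eq_measure_fin.
rewrite /weighted_energy -/(II mu mu).
have := mutual_energy_ge0 (@logk_ge0 R) mu mu.
have : (0 <= \int[mu]_x q x)%E by apply: integral_ge0 => x _; exact: shifted_ge0.
case: (II mu mu) => [r| |]//; case: (\int[mu]_x q x)%E => [s| |]// _ _ _ _ [] h.
transitivity (r + 2 * s - 2 * c - (s - c))%:E => //.
by rewrite -h; congr EFin; ring.
Qed.

Lemma pot_weight_lsc : lsc (fun x => pot mu x + q x)%E.
Proof.
apply: lscD; [exact: pot_ge0|exact: shifted_ge0| |exact: shifted_lsc].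
by move=> x a; exact: pot_lsc.
Qed.

(** A strict violation at [x] would persist, by lower semicontinuity, on a ball about [x]; such a
    ball has positive mass, against [minimizer_on_support]. *)
Lemma eq_measure_on_supp x : supp mu x -> (pot mu x + q x <= eq_const%:E)%E.
Proof.
move=> sx; rewrite leNgt; apply/negP => lt.
have [a fa ax] : exists2 a : R, eq_const < a & (a%:E < pot mu x + q x)%E.
  move: lt; case: (pot mu x + q x)%E => [r| |]//.
    by rewrite lte_fin => h; exists ((eq_const + r) / 2); rewrite ?lte_fin; lra.
  by move=> _; exists (eq_const + 1); rewrite ?ltry// ltrDl.
have [e e0 eU] := nbhs_edist (pot_weight_lsc ax).
apply: (@minimizer_on_support _ _ _ _ _ (@measurable_logk R) (@logk_ge0 R) (@logk_sym R)
  mq shifted_ge0 K mu mK muK eq_measure_min eq_measure_fin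
  [set y | edist y x < e] a%:E).
- exact: measurable_edist_ball.
- apply: sx; first exact: open_edist_ball.
  by rewrite /= (_ : edist x x = 0)//; apply/eqP; rewrite edist_eq0.
- by rewrite eq_constE lte_fin.
- by move=> y /eU/ltW.
Qed.

Lemma exceptional_logpolar :
  logpolar [set x | K x /\ (pot mu x + q x < eq_const%:E)%E].
Proof.
split.
  rewrite (_ : mkset _ = K `&` [set x | (pot mu x + q x < eq_const%:E)%E])//.
  apply: emeasurable_fun_infty_o => //; apply: measurable_funTS.
  by apply: emeasurable_funD => //; exact: measurable_pot.
move=> C comC CE nu nuC; have mC := compact_measurable3 comC.
have CK : C `<=` K by move=> x /CE[].
rewrite energy_mutual; last first.
  apply: prob_on_sphere; apply: (@subset_measure0 _ _ _ _ _ (~` C)) => //; try exact: measurableC.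
  exact: subsetC.
apply: (@minimizer_quasi_everywhere _ _ _ _ _ (@measurable_logk R) (@logk_ge0 R) (@logk_sym R)
  mq shifted_ge0 K mu mK muK eq_measure_min eq_measure_fin nu C) => // x Cx.
by rewrite eq_constE; case: (CE x Cx).
Qed.

Lemma supp_minus_logpolar_dense (P : set (pt3 R)) y (U : set (pt3 R)) :
  logpolar P -> supp mu y -> nbhs y U -> exists z, [/\ supp mu z, ~ P z & U z].
Proof.
move=> [mP Ppol] sy /nbhs_edist[e e0 eU]; apply: contrapT => h.
have sP z : supp mu z -> edist z y < e -> P z.
  by move=> sz zy; apply: contrapT => nPz; apply: h; exists z; split => //; exact: eU.
(* If the claim failed, this compact set of positive mass would lie in [P]; but [mu] conditioned to
   it has finite energy. *)
pose C := supp mu `&` [set z | edist z y <= e / 2].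
have clC : closed C.
  apply: closedI; first exact: closed_supp.
  apply: (@preimage_closed _ _ (fun z : R * R * R => edist z y) [set r : R | r <= e / 2]).
    by move=> z _; exact: continuous_edist.
  exact: closed_le.
have comC : compact C.
  apply: (@subclosed_compact _ _ (K : set (R * R * R))) => //.
  by move=> z [/(supp_sub clK muK)].
have CP : C `<=` P.
  by move=> z [sz /= zy]; apply: sP => //; rewrite (le_lt_trans zy)//; lra.
have mC := closed_measurable3 clC.
pose b := [set z | edist z y < e / 2]; have mb : measurable b := measurable_edist_ball y _.
have bpos : (0 < mu b)%E.
  apply: sy; first exact: open_edist_ball.
  rewrite /b/= (_ : edist y y = 0) ?divr_gt0//.
  by apply/eqP; rewrite edist_eq0.
have ms : measurable (supp mu) by apply: closed_measurable3; exact: closed_supp.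
have Cpos : (0 < mu C)%E.
  apply: (lt_le_trans bpos).
  rewrite (@le_trans _ _ (mu (C `|` ~` supp mu)))//.
    apply: le_measure; rewrite ?inE//; first by apply: measurableU => //; exact: measurableC.
    move=> z bz; have [sz|] := pselect (supp mu z); last by right.
    by left; split => //=; exact: ltW.
  rewrite (le_trans (measureU2 mu mC (measurableC ms)))//.
  rewrite -[leRHS]adde0; apply: leeD => //.
  by rewrite le_eqVlt; apply/orP; left; apply/eqP; exact: supp_null.
have [tau [tauB tauf]] := conditional_exists mC Cpos.
set a := (fine (mu C))^-1 in tauB tauf.
have a0 : 0 <= a by rewrite invr_ge0 fine_ge0.
have tauC : prob_on C tau.
  by rewrite /prob_on tauB ?setICl ?measure0 ?mule0//; exact: measurableC.
have CK : C `<=` K by move=> z [/(supp_sub clK muK)].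
have := Ppol C comC CP tau tauC.
rewrite energy_mutual; last first.
  apply: prob_on_sphere; apply: (@subset_measure0 _ _ _ _ _ (~` C)) => //; try exact: measurableC.
  exact: subsetC.
apply/eqP; rewrite -ltey.
apply: (dominated_energy_lty (@measurable_logk R) (@logk_ge0 R) (c := a) (mu := mu)) => //.
  move=> f mf f0; rewrite tauf//; apply: lee_wpmul2l; first by rewrite lee_fin.
  by apply: ge0_subset_integral.
by have [] := weighted_energy_lty (@logk_ge0 R) shifted_ge0 eq_measure_fin.
Qed.

End Equilibrium.

(** The limit as [d] tends to 0, made explicit. It serves with [p] a value of [pk] and [W] of the
    exponential at a point of the support, approximated by points at distance less than [d]. *)
Lemma perturbed_bound (R : realType) (n p W M : R) :
  0 <= n -> 0 <= p -> 0 <= W -> 0 <= M ->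
  (forall d, 0 < d -> (p - n * d) * (W * expR (- (n * d))) <= M) -> p * W <= M.
Proof.
move=> n0 p0 W0 M0 H; apply/ler_addgt0Pr => e e0.
have V0 : 0 <= p * W by rewrite mulr_ge0.
have N0 : 0 < n * (W + p * W) + 1 by rewrite ltr_wpDl// mulr_ge0// addr_ge0.
pose d := e / (n * (W + p * W) + 1); have d0 : 0 < d by rewrite divr_gt0.
have dE : d * (n * (W + p * W) + 1) = e by rewrite /d divfK// gt_eqF.
have := H d d0; have : 1 - n * d <= expR (- (n * d)) by exact: expR_ge1Dx.
have nd0 : 0 <= n * d by rewrite mulr_ge0// ltW.
move: (expR _) nd0 dE; clearbody d => x nd0 dE ex h.
have nde : n * d * W + n * d * (p * W) <= e.
  by rewrite -dE (_ : _ + _ = d * (n * (W + p * W))) ?mulrDr ?mulr1 ?lerDl ?ltW//; ring.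
have [pd|pd] := lerP p (n * d).
  have : p * W <= n * d * W by rewrite ler_wpM2r.
  have : 0 <= n * d * (p * W) by rewrite mulr_ge0.
  lra.
have : (p - n * d) * W * (1 - n * d) <= (p - n * d) * W * x.
  by rewrite ler_wpM2l// mulr_ge0// subr_ge0 ltW.
have : 0 <= n * d * (n * d * W) by apply: mulr_ge0 => //; exact: mulr_ge0.
lra.
Qed.

Theorem theorem8p1 (R : realType) (K : set (pt3 R)) (Q : pt3 R -> \bar R)
    (mu : probability (pt3 R) R) (k : nat) (xs : 'I_k -> pt3 R) (M : R) :
  closed K -> K `<=` (@sphereS R) -> ~ logpolar K -> admissible K Q ->
  is_eq_measure K Q mu ->
  (forall j, (@sphereS R) (xs j)) ->
  (exists P : set (pt3 R), logpolar P /\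
     forall x, supp mu x -> ~ P x ->
       ((pk xs x)%:E * expeR (- (k%:R%:E * Q x)) <= M%:E)%E) ->
  (forall x, (@sphereS R) x ->
     ((pk xs x)%:E <= M%:E * expeR (k%:R%:E * (- Upot mu x + Fw K Q mu)))%E) /\
  (exists Pt : set (pt3 R), logpolar Pt /\
     forall x, K x -> ~ Pt x ->
       ((pk xs x)%:E * expeR (- (k%:R%:E * Q x)) <= M%:E)%E).
Proof.
move=> clK KS _ admQ muQ Sxs [P [Ppol HP]].
have [c c0 Qc] := weight_bounded_below clK KS admQ.
have muK : prob_on K mu by case: muQ.
have muS := prob_on_sphere clK KS muK.
pose f := eq_const K Q c mu.
have onsupp := eq_measure_on_supp clK KS admQ c0 Qc muQ.
have potf y : supp mu y -> (potential (@logk R) mu y <= f%:E)%E.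
  move=> sy; apply: le_trans (onsupp y sy).
  by rewrite leeDl// shifted_ge0.
have uE := upotE muS potf.
pose M1 := M * expR (k%:R * (f - c)).
(* On the support [U + Q <= Fw], so [Q] is finite there and [expR (k * U)] is at most
   [expR (- k * Q) * expR (k * Fw)]; here [Fw] is [f - c]. *)
have offP y : supp mu y -> ~ P y -> 0 <= M /\
    pk xs y * expR (k%:R * upot mu y) <= M1.
  move=> sy nPy; have := HP y sy nPy; have := onsupp y sy; rewrite uE.
  have Ky := supp_sub clK muK sy.
  rewrite /shifted asboolT//; have := Qc y Ky.
  case: (Q y) => [r| |]// _.
  move=> ufE pME.
  have uf : upot mu y + (r + c) <= f by rewrite -lee_fin; exact: ufE.
  have pM : pk xs y * expR (- (k%:R * r)) <= M by rewrite -lee_fin; exact: pME.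
  split.
    by rewrite (le_trans _ pM)// mulr_ge0 ?pk_ge0 ?expR_ge0.
  apply: (@le_trans _ _ (pk xs y * expR (- (k%:R * r)) * expR (k%:R * (f - c)))).
    rewrite -mulrA -expRD ler_wpM2l ?pk_ge0// ler_expR -mulrN -mulrDr.
    by rewrite ler_wpM2l//; lra.
  by rewrite ler_wpM2r ?expR_ge0.
have dense := supp_minus_logpolar_dense clK KS admQ c0 Qc muQ Ppol.
have M0 : 0 <= M.
  have [y sy] : supp mu !=set0.
    apply/set0P/eqP => Ze; have := supp_null mu; rewrite Ze setC0 probability_setT.
    by move=> /eqP; rewrite onee_eq0.
  by have [z [sz nPz _]] := dense y setT sy filterT; have [] := offP z sz nPz.
have M10 : 0 <= M1 by rewrite mulr_ge0 ?expR_ge0.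
(* Points of [P] are approached by points [z] of the support outside [P], where the potential is at
   least [upot mu y - d] and [pk] differs little. *)
have HM y : supp mu y -> pk xs y * expR (k%:R * upot mu y) <= M1.
  move=> sy; apply: (@perturbed_bound _ k%:R) => //.
    exact: pk_ge0.
  move=> d d0.
  have near_u : \forall z \near y, ((upot mu y - d)%:E < potential (@logk R) mu z)%E.
    by apply: pot_lsc; rewrite uE lte_fin ltrBlDr ltrDl.
  have [z [sz nPz [uz zy]]] := dense y _ sy (filterI near_u (near_edist y d0)).
  move: uz; rewrite uE lte_fin => uz.
  have [_ zM] := offP z sz nPz.
  have Sy := KS _ (supp_sub clK muK sy); have Sz := KS _ (supp_sub clK muK sz).
  have pyz := pk_lipschitz Sxs Sy Sz; rewrite edistC in pyz.
  have kd : k%:R * edist z y <= k%:R * d by rewrite ler_wpM2l// ltW.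
  apply: le_trans zM; rewrite -expRD -mulrN -mulrDr.
  apply: (@le_trans _ _ (pk xs z * expR (k%:R * (upot mu y - d)))).
    rewrite ler_wpM2r ?expR_ge0// mulrN lerBlDr (le_trans pyz)//.
    by rewrite lerD2l.
  apply: ler_wpM2l; first exact: pk_ge0.
  by rewrite ler_expR; apply: ler_wpM2l => //; exact: ltW.
have dom := domination muS potf Sxs HM.
have dom' x : sphereS x -> pk xs x <= M * expR (k%:R * (- upot mu x + (f - c))).
  move=> Sx; rewrite mulrDr expRD mulrN expRN mulrCA mulrC.
  by rewrite ler_pdivlMr ?expR_gt0//; exact: dom.
split.
  move=> x Sx; rewrite (Upot_pot muS Sx) uE (FwE clK KS admQ c0 Qc muQ) -/f.
  by have := dom' x Sx; rewrite -lee_fin.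
(* Off this set [U + Q >= Fw], which cancels the exponential in the bound on the sphere. *)
eexists; split; first exact: (exceptional_logpolar clK KS admQ c0 Qc muQ).
move=> x Kx nE; have Sx := KS x Kx; have := dom' x Sx.
have : (f%:E <= potential (@logk R) mu x + shifted K Q c x)%E.
  by rewrite leNgt; apply/negP => lt; apply: nE; split.
rewrite uE /shifted asboolT//; have := Qc x Kx.
case: (Q x) => [r| |]// _.
  move=> fuE px.
  have fu : f <= upot mu x + (r + c) by rewrite -lee_fin; exact: fuE.
  suff : pk xs x * expR (- (k%:R * r)) <= M by rewrite -lee_fin.
  apply: (@le_trans _ _ (M * expR (k%:R * (- upot mu x + (f - c))) * expR (- (k%:R * r)))).
    by rewrite ler_wpM2r ?expR_ge0.
  rewrite -mulrA -expRD ler_piMr// -expR0 ler_expR -mulrN -mulrDr.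
  by rewrite mulr_ge0_le0//; lra.
(* Case [Q x = +oo]: for positive degree the exponential vanishes, while for degree 0 the convention
   [0 * +oo = 0] makes it 1 and the bound on the sphere is what is needed. *)
move=> _; case: k xs Sxs {HP M1 offP M10 HM dom dom'} => [|k] xs Sxs.
  by rewrite !mul0r expR0 mulr1 mul0e oppe0 expeR0 mule1 lee_fin.
by move=> _; rewrite mulry gtr0_sg ?ltr0n// mul1e /= mule0 lee_fin.
Qed.
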